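(* In the setting of the context, let $B_g:\mathcal{K}_0\to\mathcal{K}_0\mathcal{K}_0\mathcal{K}_0^*$ ($g\in G$) be linear maps and let $b^{r,s}_{t,u}(g)=T_0(e_s)^*T_0(e_r)^*B_g(e_u)T_0(e_t)\in\mathbb{C}$ for $r,s,t,u\in\Lambda$. Then the system of equations (E1)–(E10) of the context (for all $g,h,k\in G$, $\xi,\eta,\zeta\in\mathcal{K}_0$) is equivalent to the following system, required for all $g,h,k\in G$ and all indices in $\Lambda$: $$\text{(p1)}\quad\frac1{\sqrt n}\sum_{h\in G}\langle g,h\rangle b^{r,s}_{t,u}(h)=\epsilon\epsilon_r\epsilon_tc_ua(g)\chi_u(g)b^{s,\overline t}_{\overline r,u}(g),$$ $$\text{(p2)}\quad\sum_rb^{r,s}_{r,u}(0)=-\frac{\delta_{s,u}}d,\qquad\text{(p3)}\quad\sum_sb^{r,s}_{t,s}(0)=-\frac{\delta_{r,t}}d,$$ $$\text{(p4)}\quad\sum_{r,t}\overline{b^{r,s'}_{t,u'}(g)}b^{r,s}_{t,u}(g)=\frac{\delta_{s,s'}\delta_{u,u'}}n-\frac{\delta_{g,0}\delta_{s,u}\delta_{s',u'}}d,$$ $$\text{(p5)}\quad\sum_{s,u}b^{r,s}_{t,u}(g)\overline{b^{r',s}_{t',u}(g)}=\frac{\delta_{r,r'}\delta_{t,t'}}n-\frac{\delta_{g,0}\delta_{r,t}\delta_{r',t'}}d,$$ $$\text{(p6)}\quad\chi_r\chi_s\neq\chi_t\chi_u\Longrightarrow b^{r,s}_{t,u}(g)=0\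 \ \forall g\in G,$$ $$\text{(p7)}\quad\overline{b^{r,s}_{t,u}(g)}=\epsilon_s\epsilon_ua(g)\chi_u(g)b^{t,\overline s}_{r,\overline u}(-g),$$ $$\text{(p8)}\quad\overline{b^{r,s}_{t,u}(g)}=\epsilon_t\epsilon_rc_r\overline{c_t}a(g)\chi_r(g)b^{\overline r,u}_{\overline t,s}(-g),$$ $$\text{(p9)}\quad b^{r,s}_{t,u}(g)=\epsilon_r\epsilon_s\epsilon_t\epsilon_uc_t\overline{c_r}\,\overline{\chi_r(g)\chi_s(g)}\,b^{\overline t,\overline u}_{\overline r,\overline s}(g),$$ $$\text{(p10)}\quad c_r\epsilon_r\sum_{g\in G}\sum_{q,s,t}\epsilon_t\overline{c_t}\,\overline{b^{v,w}_{q,s}(g)}\,b^{\overline r,u}_{\overline t,s}(g+h)\,b^{p,x}_{q,t}(g+k)=\epsilon_u\epsilon_w\chi_r(h)\overline{\chi_u(h)\langle h,k\rangle}\sum_yb^{p,y}_{v,r}(k)b^{x,\overline w}_{y,\overline u}(h)-\frac{c_u\epsilon_{\overline p}\epsilon_v}{d\sqrt n}\delta_{r,u}\delta_{w,\overline v}\delta_{x,\overline p}.$$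
   Context: Setting. $G$ is a non-trivial finite abelian group (additive) of order $n$, $m$ is a positive multiple of $n$, $d=\frac{m+\sqrt{m^2+4n}}2$, $\epsilon\in\{1,-1\}$, $\langle\cdot,\cdot\rangle:G\times G\to\mathbb{T}$ is a non-degenerate symmetric bicharacter, $\mathcal{K}_0$ is a Hilbert space with $\dim\mathcal{K}_0=m/n$ (inner products linear in the first variable), $A(g)$ ($g\in G$) and $C$ are mutually commuting unitaries and $J$ an anti-unitary on $\mathcal{K}_0$ with $J^2=\epsilon$, $JC=C^*J$, $JA(g)=A(-g)^*J$, $A(g)A(h)=\langle g,h\rangle A(g+h)$, $\frac1{\sqrt n}\sum_gA(g)=C^{-3}$. $\{e_t\}_{t\in\Lambda}$ is an orthonormal basis of $\mathcal{K}_0$, with an involution $t\mapsto\overline t$ of $\Lambda$, such that $A(g)e_t=a(g)\chi_t(g)e_t$, $Ce_t=c_te_t$, $Je_t=\epsilon_te_{\overline t}$, where $a:G\to\mathbb{T}$ satisfies $a(-g)=a(g)$, $a(g)a(h)=\langle g,h\rangle a(g+h)$; $\chi_t\in\hat G=\mathrm{Hom}(G,\mathbb{T})$, $\chi_{\overline t}=\chi_t^{-1}$; $c_t\in\mathbb{T}$, $c_{\overline t}=c_t$, $\sum_ga(g)\chi_t(g)=\sqrt nc_t^{-3}$; $\epsilon_t\in\{1,-1\}$, $\epsilon_t\epsilon_{\overline t}=\epsilon$. Notation. $T_0$ is a linear map from $\mathcal{K}_0$ into a unital C$^*$-algebra (e.g. the Cuntz algebra $\mathcal{O}_{n+m}$,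 with $\{T_0(e_s)\}$ part of the canonical generators) with $T_0(\eta)^*T_0(\xi)=\langle\xi,\eta\rangle1$. $\mathcal{K}_0\mathcal{K}_0\mathcal{K}_0^*$ is the span of the elements $T_0(\xi)T_0(\eta)T_0(\zeta)^*$. $\xi$ and $T_0(\xi)$ are identified, so $J,C,A(g),B_g$ can be applied to elements of $T_0(\mathcal{K}_0)$. $X\in\mathbb{B}(\mathcal{K}_0)$ is identified with $\sum_sT_0(Xe_s)T_0(e_s)^*$ and $X\otimes Y$ with $\sum_{s,t}T_0(Xe_s)T_0(Ye_t)T_0(e_t)^*T_0(e_s)^*$; $Q_0=\sum_sT_0(e_s)T_0(e_s)^*$, $Q_0\otimes Q_0=\sum_{s,t}T_0(e_s)T_0(e_t)T_0(e_t)^*T_0(e_s)^*$. Thus $B_g(e_u)=\sum_{r,s,t}b^{r,s}_{t,u}(g)T_0(e_r)T_0(e_s)T_0(e_t)^*$. Put $\hat B_g(\xi)=\frac1{\sqrt n}\sum_h\overline{\langle g,h\rangle}B_h(\xi)$. The equations: (E1) $\sum_sT_0(Je_s)^*T_0(e_s)^*\hat B_0(\xi)=-\frac1dT_0(C^*J\xi)^*$. (E2) $\hat B_h(\eta)^*\hat B_h(\xi)=\frac{\langle\xi,\eta\rangle}nQ_0-\frac{\delta_{h,0}}dT_0(C^*J\eta)T_0(C^*J\xi)^*$. (E3) $B_g(A(h)\xi)=(A(h)\otimes A(h))B_g(\xi)A(h)^*$. (E4) $B_g(\xi)^*=\epsilon\sum_{s,t}T_0(e_s)T_0(Je_t)^*T_0(e_t)^*T_0(e_s)^*B_{-g}(A(-g)J\xi)$.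 (E5) $\hat B_g(\xi)=\epsilon\sum_{s,t,r}\big(T_0(e_t)^*T_0(e_s)^*B_{-g}(A(-g)C\xi)T_0(e_r)\big)T_0(Je_r)T_0(e_s)T_0(Je_t)^*$. (E6) $\sum_r\hat B_g(e_r)\hat B_g(e_r)^*=\frac1nQ_0\otimes Q_0-\frac{\delta_{g,0}}d\sum_{s,t}T_0(e_s)T_0(Je_s)T_0(Je_t)^*T_0(e_t)^*$. (E7) $(\frac mn-\frac1d)T_0(\xi)=\sum_{h,s,t}T_0(A(-h)^*C^*Je_s)^*B_{-h}(T_0(e_s)^*B_h(\xi)T_0(e_t))T_0(C^*Je_t)$. (E8) $\delta_{g,0}\langle\eta,\zeta\rangle T_0(\xi)-\frac1d\langle\xi,\zeta\rangle T_0(\eta)=\sum_{h,s}T_0(J\eta)^*B_{g-h}(e_s)T_0(C^*JB_h(\xi)^*T_0(A(h)^*C^*\zeta)T_0(e_s))$. (E9) $\epsilon C^*A(k)^*T_0(A(-k)^*\zeta)^*B_{g-k}(\xi)T_0(\eta)=\frac1{\sqrt n}\sum_h\overline{\langle g,h\rangle}B_{h-k}(\zeta)^*T_0(C^*A(h)^*\eta)T_0(C^*A(g)^*\xi)$. (E10) $\sum_{g\in G,t}B_g(T_0(A(-g-h)^*\zeta)^*B_{-g-h}(\xi)T_0(e_t))B_{g+k}(e_t)^*T_0(\eta)=\langle h,k\rangle B_k(A(-h)^*\zeta)^*T_0(\eta)B_{-h}(\xi)-\frac\epsilon{d\sqrt n}\langle C^*\xi,\zeta\rangle\sum_tT_0(e_t)T_0(Je_t)T_0(J\eta)^*$.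 *)

(* Defs.v *)
From HB Require Import structures.
From mathcomp Require Import all_boot all_order all_algebra.
From mathcomp Require Import sesquilinear complex.
From mathcomp Require Import boolp classical_sets reals.

Set Implicit Arguments.
Unset Strict Implicit.
Unset Printing Implicit Defensive.

Import Order.TTheory GRing.Theory Num.Theory Num.Def.

Local Open Scope ring_scope.
Local Open Scope classical_set_scope.

(* Complex conjugation is always Num.conj (z^* in ring_scope); complex_scope,
   whose own z^* is conjc, stays closed. *)

Section Operators.
Variables (R : realType) (K0 : vectType R[i]) (ip : {dot K0 for (@conjC R[i])}).

(* Forms of type {dot _ for conjC} are linear in the first variable and
   conjugate-linear in the second; K0 being finite-dimensional, it is complete. *)

Definition unitary (X : 'End(K0)) : Prop :=
  (forall x y, ip (X x) (X y) = ip x y) /\ (forall y, exists x, X x = y).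

Definition antiunitary (J : K0 -> K0) : Prop :=
  [/\ forall (z : R[i]) x y, J (z *: x + y) = z^* *: J x + J y,
      forall x y, ip (J x) (J y) = ip y x
    & forall y, exists x, J x = y].

Definition adjoint (X : 'End(K0)) : 'End(K0) :=
  xget 0 [set Y : 'End(K0) | forall x y, ip (X x) y = ip x (Y y)].

Definition orthonormal_basis (L : finType) (e : L -> K0) : Prop :=
  (forall s t, ip (e s) (e t) = (s == t)%:R) /\ <<codom e>>%VS = fullv.

Lemma adjointE (L : finType) (e : L -> K0) (X : 'End(K0)) :
  orthonormal_basis e -> forall x y, ip (X x) y = ip x (adjoint X y).
Proof.
move=> [oe se]; rewrite /adjoint; case: xgetP => [Y _ //|/= noY].
pose F y := \sum_t ip y (X (e t)) *: e t.
have linF : linear F.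
  move=> z x y; rewrite /F scaler_sumr -big_split; apply: eq_bigr => t _ /=.
  by rewrite linearPl scalerA -scalerDl.
pose Fl : {linear K0 -> K0} := HB.pack F (GRing.isLinear.Build _ _ _ _ F linF).
have conjip x y : (ip y x)^* = ip x y.
  by rewrite (hermC ip x y) expr0 mul1r.
case: (noY (linfun Fl)) => x y; rewrite lfunE /= /F.
have [k ->] : exists k : L -> R[i], x = \sum_t k t *: e t.
  have : x \in <<codom e>>%VS by rewrite se memvf.
  rewrite span_def big_image /= => /memv_sumP[v vP ->].
  have /all_sig[k kP] t : {z | v t = z *: e t}.
    by apply: cid; apply/vlineP; exact: vP.
  by exists k; apply: eq_bigr => t _; exact: kP.
rewrite linear_sum linear_sumlz linear_sumlz; apply: eq_bigr => s _.
rewrite linearZ linearZl_LR linearZl_LR; congr (_ * _).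
rewrite linear_sumr (bigD1 s) //= big1 => [|t /negPf ts].
  by rewrite linearZr_LR /= oe eqxx mulr1 addr0 conjip.
by rewrite linearZr_LR /= oe eq_sym ts mulr0.
Qed.

End Operators.

Section Characters.
Variables (R : realType) (G : finZmodType).

Definition character (chi : G -> R[i]) : Prop :=
  (forall g, `|chi g| = 1) /\ (forall g h, chi (g + h) = chi g * chi h).

Definition symmetric_bicharacter (pair : G -> G -> R[i]) : Prop :=
  (forall g, character (pair g)) /\ (forall g h, pair g h = pair h g).

Definition nondegenerate_pairing (pair : G -> G -> R[i]) : Prop :=
  forall g, (forall h, pair g h = 1) -> g = 0.

End Characters.

(* Unitality and 1 != 0 come from algType. *)
Record cstar_algebra (R : realType) (D : algType R[i])
    (star : D -> D) (nrm : D -> R) : Prop := CStarAlgebra {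
  starK : forall x, star (star x) = x;
  starD : forall x y, star (x + y) = star x + star y;
  starZ : forall (z : R[i]) x, star (z *: x) = z^* *: star x;
  starM : forall x y, star (x * y) = star y * star x;
  nrm_eq0 : forall x, nrm x = 0 -> x = 0;
  nrmD : forall x y, nrm (x + y) <= nrm x + nrm y;
  nrmZ : forall (z : R[i]) x, (nrm (z *: x))%:C%C = `|z| * (nrm x)%:C%C;
  nrmM : forall x y, nrm (x * y) <= nrm x * nrm y;
  nrm_star : forall x, nrm (star x * x) = nrm x ^+ 2;
  nrm_complete : forall u : nat -> D,
    (forall r : R, 0 < r -> exists N : nat, forall i j : nat,
       (N <= i)%N -> (N <= j)%N -> nrm (u i - u j) < r) ->
    exists l : D, forall r : R, 0 < r -> exists N : nat, forall i : nat,
       (N <= i)%N -> nrm (u i - l) < r }.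

Definition sqrtn (R : realType) (G : finZmodType) : R[i] :=
  (Num.sqrt (#|G|%:R : R))%:C%C.

Definition dconst (R : realType) (G : finZmodType) (m : nat) : R[i] :=
  ((m%:R + Num.sqrt (m%:R ^+ 2 + 4 * #|G|%:R)) / 2 : R)%:C%C.

Section CuntzImage.
Variables (R : realType) (K0 : vectType R[i]) (D : algType R[i]).
Variables (star : D -> D) (T0 : {linear K0 -> D}).

(* the linear span of the products T0 x * T0 y * (T0 z)^* *)
Definition KKKstar : set D :=
  [set w | exists s : seq (R[i] * (K0 * K0 * K0)),
     w = \sum_(p <- s)
           p.1 *: (T0 p.2.1.1 * T0 p.2.1.2 * star (T0 p.2.2))].

(* inverse of T0 on its image: it realises the identification of x with T0 x *)
Definition T0inv (w : D) : K0 := xget 0 [set x | T0 x = w].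

Definition scalar_of (w : D) : R[i] := xget 0 [set z : R[i] | z *: 1 = w].

Definition bcoef (G : finZmodType) (L : finType) (e : L -> K0)
    (B : G -> {linear K0 -> D}) (g : G) (r s t u : L) : R[i] :=
  scalar_of (star (T0 (e s)) * star (T0 (e r)) * B g (e u) * T0 (e t)).

Section Identification.
Variables (ip : {dot K0 for (@conjC R[i])}).
Hypothesis isoT0 : forall x y, star (T0 y) * T0 x = ip x y *: 1.

Lemma T0_inj : injective T0.
Proof.
move=> x y xy; apply/eqP; rewrite -subr_eq0; apply/negPn/negP => neq.
have gt0 := @neq0_dnorm_gt0 _ _ _ ip _ neq.
have := isoT0 (x - y) (x - y); rewrite linearB xy subrr mulr0 => /eqP.
by rewrite eq_sym scaler_eq0 oner_eq0 orbF gt_eqF.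
Qed.

Lemma T0invK x : T0inv (T0 x) = x.
Proof.
by rewrite /T0inv; case: xgetP => [y _ /= /T0_inj //|/(_ x) /= []].
Qed.

Lemma scalar_ofK (z : R[i]) : scalar_of (z *: 1) = z.
Proof.
rewrite /scalar_of; case: xgetP => [y _ /= /eqP|/(_ z) /= [] //].
by rewrite -subr_eq0 -scalerBl scaler_eq0 oner_eq0 orbF subr_eq0 => /eqP.
Qed.

Lemma bcoefE (G : finZmodType) (L : finType) (e : L -> K0)
    (B : G -> {linear K0 -> D}) g r s t u : KKKstar (B g (e u)) ->
  bcoef e B g r s t u *: 1
  = star (T0 (e s)) * star (T0 (e r)) * B g (e u) * T0 (e t).
Proof.
rewrite /bcoef => -[l ->].
suff [z ->] : exists z : R[i], star (T0 (e s)) * star (T0 (e r)) *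
    (\sum_(p <- l) p.1 *: (T0 p.2.1.1 * T0 p.2.1.2 * star (T0 p.2.2)))
    * T0 (e t) = z *: 1.
  by rewrite scalar_ofK.
elim: l => [|p l [z IH]].
  by exists 0; rewrite big_nil mulr0 mul0r scale0r.
exists (p.1 * (ip p.2.1.1 (e r) * (ip p.2.1.2 (e s) * ip (e t) p.2.2)) + z).
rewrite big_cons mulrDr mulrDl IH scalerDl; congr (_ + _).
rewrite -scalerAr -scalerAl -scalerA; congr (_ *: _).
rewrite -!mulrA isoT0 -!scalerAr mulr1 [star (T0 (e r)) * _]mulrA isoT0.
rewrite -scalerAl mul1r -scalerAr isoT0 !scalerA; congr (_ *: _).
by rewrite -mulrA mulrC -mulrA.
Qed.

End Identification.

End CuntzImage.

Section OperatorSystem.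
Variables (R : realType) (G : finZmodType) (m : nat) (eps : R[i]).
Variables (pair : G -> G -> R[i]) (K0 : vectType R[i]).
Variables (ip : {dot K0 for (@conjC R[i])}).
Variables (A : G -> 'End(K0)) (C : 'End(K0)) (J : K0 -> K0).
Variables (L : finType) (e : L -> K0).
Variables (D : algType R[i]) (star : D -> D) (T0 : {linear K0 -> D}).
Variables (B : G -> {linear K0 -> D}).

Local Notation d := (dconst R G m).
Local Notation sqn := (sqrtn R G).
Local Notation n := (#|G|%:R : R[i]).
Local Notation "x ^st" := (star x) (at level 2, format "x ^st").
Local Notation Cst := (adjoint ip C).
Local Notation Ast g := (adjoint ip (A g)).
Local Notation unT := (T0inv T0).

Definition hatB (g : G) (x : K0) : D :=
  sqn^-1 *: \sum_(h : G) (pair g h)^* *: B h x.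

Definition op_elt (X : 'End(K0)) : D := \sum_s T0 (X (e s)) * (T0 (e s))^st.

Definition tens_elt (X Y : 'End(K0)) : D :=
  \sum_s \sum_t
    T0 (X (e s)) * T0 (Y (e t)) * (T0 (e t))^st * (T0 (e s))^st.

Definition Q0 : D := \sum_s T0 (e s) * (T0 (e s))^st.

Definition Q0Q0 : D :=
  \sum_s \sum_t T0 (e s) * T0 (e t) * (T0 (e t))^st * (T0 (e s))^st.

Definition E1 : Prop := forall xi : K0,
  \sum_s (T0 (J (e s)))^st * (T0 (e s))^st * hatB 0 xi
  = - (d^-1 *: (T0 (Cst (J xi)))^st).

Definition E2 : Prop := forall (h : G) (xi eta : K0),
  (hatB h eta)^st * hatB h xi
  = (ip xi eta / n) *: Q0
    - ((h == 0)%:R / d) *: (T0 (Cst (J eta)) * (T0 (Cst (J xi)))^st).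

Definition E3 : Prop := forall (g h : G) (xi : K0),
  B g (A h xi) = tens_elt (A h) (A h) * B g xi * op_elt (Ast h).

Definition E4 : Prop := forall (g : G) (xi : K0),
  (B g xi)^st
  = eps *: \sum_s \sum_t
      T0 (e s) * (T0 (J (e t)))^st * (T0 (e t))^st * (T0 (e s))^st
      * B (- g) (A (- g) (J xi)).

Definition E5 : Prop := forall (g : G) (xi : K0),
  hatB g xi
  = eps *: \sum_s \sum_t \sum_r
      ((T0 (e t))^st * (T0 (e s))^st * B (- g) (A (- g) (C xi)) * T0 (e r))
      * T0 (J (e r)) * T0 (e s) * (T0 (J (e t)))^st.

Definition E6 : Prop := forall g : G,
  \sum_r hatB g (e r) * (hatB g (e r))^st
  = n^-1 *: Q0Q0
    - ((g == 0)%:R / d) *: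
        \sum_s \sum_t
          T0 (e s) * T0 (J (e s)) * (T0 (J (e t)))^st * (T0 (e t))^st.

Definition E7 : Prop := forall xi : K0,
  (m%:R / n - d^-1) *: T0 xi
  = \sum_(h : G) \sum_s \sum_t
      (T0 (Ast (- h) (Cst (J (e s)))))^st
      * B (- h) (unT ((T0 (e s))^st * B h xi * T0 (e t)))
      * T0 (Cst (J (e t))).

Definition E8 : Prop := forall (g : G) (xi eta zeta : K0),
  ((g == 0)%:R * ip eta zeta) *: T0 xi - (d^-1 * ip xi zeta) *: T0 eta
  = \sum_(h : G) \sum_s
      (T0 (J eta))^st * B (g - h) (e s)
      * T0 (Cst (J (unT ((B h xi)^st * T0 (Ast h (Cst zeta)) * T0 (e s))))).

Definition E9 : Prop := forall (g k : G) (xi eta zeta : K0),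
  eps *: T0 (Cst (Ast k (unT
           ((T0 (Ast (- k) zeta))^st * B (g - k) xi * T0 eta))))
  = sqn^-1 *: \sum_(h : G) (pair g h)^* *:
      ((B (h - k) zeta)^st * T0 (Cst (Ast h eta)) * T0 (Cst (Ast g xi))).

Definition E10 : Prop := forall (h k : G) (xi eta zeta : K0),
  \sum_(g : G) \sum_t
    B g (unT ((T0 (Ast (- g - h) zeta))^st * B (- g - h) xi * T0 (e t)))
    * (B (g + k) (e t))^st * T0 eta
  = pair h k *: ((B k (Ast (- h) zeta))^st * T0 eta * B (- h) xi)
    - (eps / (d * sqn) * ip (Cst xi) zeta) *:
        \sum_t T0 (e t) * T0 (J (e t)) * (T0 (J eta))^st.

Definition operator_system : Prop :=
  (E1 /\ E2 /\ E3 /\ E4 /\ E5) /\ (E6 /\ E7 /\ E8 /\ E9 /\ E10).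

End OperatorSystem.

Section PolynomialSystem.
Variables (R : realType) (G : finZmodType) (m : nat) (eps : R[i]).
Variables (pair : G -> G -> R[i]) (L : finType) (bar : L -> L).
Variables (a : G -> R[i]) (chi : L -> G -> R[i]) (c epsL : L -> R[i]).
(* b g r s t u has upper indices r, s and lower indices t, u *)
Variable (b : G -> L -> L -> L -> L -> R[i]).

Local Notation d := (dconst R G m).
Local Notation sqn := (sqrtn R G).
Local Notation n := (#|G|%:R : R[i]).
Local Notation dl x y := ((x == y)%:R : R[i]).

Definition p1 : Prop := forall g r s t u,
  sqn^-1 * \sum_(h : G) pair g h * b h r s t u
  = eps * epsL r * epsL t * c u * a g * chi u g * b g s (bar t) (bar r) u.

Definition p2 : Prop := forall s u, \sum_r b 0 r s r u = - (dl s u / d).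

Definition p3 : Prop := forall r t, \sum_s b 0 r s t s = - (dl r t / d).

Definition p4 : Prop := forall g s s' u u',
  \sum_r \sum_t (b g r s' t u')^* * b g r s t u
  = dl s s' * dl u u' / n - dl g 0 * dl s u * dl s' u' / d.

Definition p5 : Prop := forall g r r' t t',
  \sum_s \sum_u b g r s t u * (b g r' s t' u)^*
  = dl r r' * dl t t' / n - dl g 0 * dl r t * dl r' t' / d.

Definition p6 : Prop := forall r s t u,
  chi r \* chi s <> chi t \* chi u -> forall g, b g r s t u = 0.

Definition p7 : Prop := forall g r s t u,
  (b g r s t u)^*
  = epsL s * epsL u * a g * chi u g * b (- g) t (bar s) r (bar u).

Definition p8 : Prop := forall g r s t u,
  (b g r s t u)^*
  = epsL t * epsL r * c r * (c t)^* * a g * chi r g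
    * b (- g) (bar r) u (bar t) s.

Definition p9 : Prop := forall g r s t u,
  b g r s t u
  = epsL r * epsL s * epsL t * epsL u * c t * (c r)^*
    * (chi r g * chi s g)^* * b g (bar t) (bar u) (bar r) (bar s).

Definition p10 : Prop := forall h k r u v w p x,
  c r * epsL r *
    \sum_(g : G) \sum_q \sum_s \sum_t
      epsL t * (c t)^* * (b g v w q s)^* * b (g + h) (bar r) u (bar t) s
      * b (g + k) p x q t
  = epsL u * epsL w * chi r h * (chi u h * pair h k)^*
      * (\sum_y b k p y v r * b h x (bar w) y (bar u))
    - c u * epsL (bar p) * epsL v / (d * sqn)
      * dl r u * dl w (bar v) * dl x (bar p).

Definition polynomial_system : Prop :=
  (p1 /\ p2 /\ p3 /\ p4 /\ p5) /\ (p6 /\ p7 /\ p8 /\ p9 /\ p10).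

End PolynomialSystem.

(* Main.v *)
(* Multiplying by T_s^* T_r^* on the left and by T_t on the right turns each of
   E1-E10 into an identity between the coefficients b; all maps involved being
   linear or conjugate-linear, it is enough to test basis vectors.

   In coefficients E5, E4 and E3 are p1, p7 and p6.  Since p1 says that the
   Fourier transform in g rotates the indices r, s, t, it turns E1, E2, E6 into
   p2, p4, p5.  For p3, view b(0) as a matrix M from pairs (s,u) to pairs (r,t)
   and let v be the diagonal vector: p2 reads v^* M = - v^* / d and p5 reads
   M M^* = 1/n - v v^* / d, so M v = - v / d because d^2 = m d + n.  Given p4,
   E7 is the equality case of Cauchy-Schwarz for b and its transform under p8,
   hence equivalent to p8.  Then p9 follows from p6, p7, p8, and E10 is p10
   rewritten with p7 and p8.  Conversely E9 follows from p1, p6, p8, and E8 from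
   p1, p4, p6, p8 by two applications of Parseval's identity and a comparison of
   Gauss sums. *)
From HB Require Import structures.
Require Import Defs.
From mathcomp Require Import all_boot all_order all_algebra.
From mathcomp Require Import sesquilinear complex ring.
From mathcomp Require Import boolp classical_sets reals.
Set Implicit Arguments.
Unset Strict Implicit.
Unset Printing Implicit Defensive.
Import Order.TTheory GRing.Theory Num.Theory Num.Def.
Local Open Scope ring_scope.

(** * Linear and conjugate-linear maps *)

(** The range projection [Q0] of the T_s may differ from 1. Coefficients therefore determine an
    element only once it is known to be fixed by [Q0] on every leg, and the hypothesis on the range
    of [B g] supplies this. The same hypothesis puts the arguments of [T0inv] in the image of [T0],
    away from its default value.

    The dictionary is not equation by equation: (E1), (E2), (E6) are translated under p1, (E7) under
    p4, (E10) under p7 and p8. The delicate case is (E7), which contracts all indices but two, while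
    p8 is entrywise. The gap closes because m/n - 1/d is, by p4, the squared norm of b at a fixed
    last index, so (E7) asks an inner product to attain its largest possible value.

    (E8) is where the cube in the Gauss sums enters. In its 1/d term, the equation combined with p8
    and each of the two rotations contribute one factor c_u/c_x; translating a Gauss sum shows that
    the cubed ratio cancels the phase that is left. *)

Section Semilinear.
Variable F : numClosedFieldType.

Definition conj_if (b : bool) (z : F) : F := if b then z^* else z.

(** The flag lets one set of closure rules serve arguments entering linearly, such as [xi], and
    conjugate-linearly, such as [zeta]; under composition flags add modulo 2. *)
Definition semilin (b : bool) (U V : lmodType F) (f : U -> V) : Prop :=
  forall z x y, f (z *: x + y) = conj_if b z *: f x + f y.

Lemma semilin0 b (U V : lmodType F) (f : U -> V) :
  semilin b f -> f 0 = 0.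
Proof.
move=> sf; have := sf 1 0 0; rewrite scale1r addr0.
have -> : conj_if b 1 = 1 by case: b sf => _; rewrite /conj_if ?rmorph1.
by rewrite scale1r => /eqP; rewrite -subr_eq0 opprD addNKr oppr_eq0 => /eqP.
Qed.

Lemma semilinZ b (U V : lmodType F) (f : U -> V) z x :
  semilin b f -> f (z *: x) = conj_if b z *: f x.
Proof. by move=> sf; have := sf z x 0; rewrite !addr0 (semilin0 sf) addr0. Qed.

Lemma semilin_sumZ b (U V : lmodType F) (f : U -> V) (I : finType)
    (k : I -> F) (x : I -> U) :
  semilin b f ->
  f (\sum_i k i *: x i) = \sum_i conj_if b (k i) *: f (x i).
Proof.
move=> sf; have := semilin0 sf => f0.
by elim/big_rec2: _ => // i y z _ <-; rewrite sf.
Qed.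

Lemma semilin_linear (U V : lmodType F) (f : {linear U -> V}) :
  semilin false f.
Proof. by move=> z x y; rewrite linearP. Qed.

Lemma semilin_comp b b' (U V W : lmodType F) (f : V -> W) (h : U -> V) :
  semilin b f -> semilin b' h -> semilin (b (+) b') (fun x => f (h x)).
Proof.
move=> sf sh z x y; rewrite sh sf.
by case: b b' {sf sh} => -[]; rewrite /conj_if /= ?conjCK.
Qed.

Lemma semilin_sum b (U V : lmodType F) (I : finType) (f : I -> U -> V) :
  (forall i, semilin b (f i)) -> semilin b (fun x => \sum_i f i x).
Proof.
move=> sf z x y; rewrite scaler_sumr -big_split.
by apply: eq_bigr => i _; exact: sf.
Qed.

Lemma semilinD b (U V : lmodType F) (f h : U -> V) :
  semilin b f -> semilin b h -> semilin b (fun x => f x + h x).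
Proof. by move=> sf sh z x y; rewrite sf sh scalerDr addrACA. Qed.

Lemma semilin_scale b (U V : lmodType F) (k : F) (f : U -> V) :
  semilin b f -> semilin b (fun x => k *: f x).
Proof. by move=> sf z x y; rewrite sf scalerDr !scalerA mulrC. Qed.

Lemma semilinN b (U V : lmodType F) (f : U -> V) :
  semilin b f -> semilin b (fun x => - f x).
Proof. by move=> sf z x y; rewrite sf opprD scalerN. Qed.

Lemma semilin_mull b (U : lmodType F) (D : algType F) (w : D) (f : U -> D) :
  semilin b f -> semilin b (fun x => w * f x).
Proof. by move=> sf z x y; rewrite sf mulrDr scalerAr. Qed.

Lemma semilin_mulr b (U : lmodType F) (D : algType F) (w : D) (f : U -> D) :
  semilin b f -> semilin b (fun x => f x * w).
Proof. by move=> sf z x y; rewrite sf mulrDl scalerAl. Qed.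

Lemma semilin_id (U : lmodType F) : semilin false (fun x : U => x).
Proof. by []. Qed.

Lemma semilin_lin b (U V W : lmodType F) (f : {linear V -> W}) (h : U -> V) :
  semilin b h -> semilin b (fun x => f (h x)).
Proof. by move=> sh; have := semilin_comp (semilin_linear f) sh. Qed.

(** The negated flag sits on the inner map so that backward application to a goal with a known flag
    fixes the remaining premise. *)
Lemma semilin_anti b (U V W : lmodType F) (f : V -> W) (h : U -> V) :
  semilin true f -> semilin (~~ b) h -> semilin b (fun x => f (h x)).
Proof. by move=> sf sh; have := semilin_comp sf sh; rewrite /= negbK. Qed.

End Semilinear.

(** * Orthonormal bases and diagonal operators *)

Section Basis.
Variables (R : realType) (K0 : vectType R[i]) (ip : {dot K0 for (@conjC R[i])}).
Variables (L : finType) (e : L -> K0).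
Hypothesis e_basis : orthonormal_basis ip e.

Lemma dot_basis s t : ip (e s) (e t) = (s == t)%:R.
Proof. by case: e_basis. Qed.

Lemma dot_conj x y : (ip y x)^* = ip x y.
Proof. by rewrite (hermC ip x y) expr0 mul1r. Qed.

Lemma basis_expansion x : x = \sum_t ip x (e t) *: e t.
Proof.
have : x \in <<codom e>>%VS by case: e_basis => _ ->; rewrite memvf.
rewrite span_def big_image /= => /memv_sumP[v vP ->].
have /all_sig[k kP] t : {z | v t = z *: e t}.
  by apply: cid; apply/vlineP; exact: vP.
rewrite (eq_bigr _ (fun t _ => kP t)).
apply: eq_bigr => t _; congr (_ *: _).
rewrite linear_sumlz (bigD1 t) //= big1 => [|s /negPf st].
  by rewrite linearZl_LR /= dot_basis eqxx mulr1 addr0.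
by rewrite linearZl_LR /= dot_basis st mulr0.
Qed.

Lemma semilin_ext b (V : lmodType R[i]) (f h : K0 -> V) :
  semilin b f -> semilin b h -> (forall t, f (e t) = h (e t)) -> f =1 h.
Proof.
move=> sf sh fh x; rewrite (basis_expansion x) (semilin_sumZ _ _ sf).
by rewrite (semilin_sumZ _ _ sh); apply: eq_bigr => t _; rewrite fh.
Qed.

Lemma adjoint_diag (X : 'End(K0)) (k : L -> R[i]) :
  (forall t, X (e t) = k t *: e t) ->
  forall t, adjoint ip X (e t) = (k t)^* *: e t.
Proof.
move=> Xe t; rewrite [LHS]basis_expansion (bigD1 t) //= big1 => [|s /negPf st].
  rewrite addr0 -dot_conj -(adjointE X e_basis) Xe linearZl_LR /= dot_basis.
  by rewrite eqxx mulr1.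
rewrite -dot_conj -(adjointE X e_basis) Xe linearZl_LR /= dot_basis.
by rewrite st mulr0 rmorph0 scale0r.
Qed.

(** Orthonormality makes the family free. This converts the dimension hypothesis into the
    cardinality m/n of the index set, which enters p3 and (E7). *)
Lemma card_basis : \dim {:K0} = #|L|.
Proof.
apply: (@size_basis _ _ _ _ (codom_tuple e)); apply/andP; split.
  by apply/eqP; case: e_basis.
apply/freeP => k k0 i.
have ei (j : 'I_#|L|) : (codom_tuple e)`_j = e (enum_val j).
  rewrite -tnth_nth /codom_tuple tnth_map (tnth_nth (enum_val j)) /=.
  by rewrite -enum_val_nth.
have := congr1 (ip^~ (e (enum_val i))) k0.
rewrite linear_sumlz linear0l (bigD1 i) //= big1 => [|j /negPf ji].
  by rewrite addr0 linearZl_LR /= ei dot_basis eqxx mulr1.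
by rewrite linearZl_LR /= !ei dot_basis (inj_eq enum_val_inj) ji mulr0.
Qed.

End Basis.

(** * Coefficients with respect to the isometries T_t *)

Section Cuntz.
Variables (R : realType) (K0 : vectType R[i]) (ip : {dot K0 for (@conjC R[i])}).
Variables (L : finType) (e : L -> K0) (D : algType R[i]).
Variables (star : D -> D) (nrm : D -> R) (T0 : {linear K0 -> D}).
Hypothesis e_basis : orthonormal_basis ip e.
Hypothesis D_cstar : cstar_algebra star nrm.
Hypothesis T0_isometry : forall x y, star (T0 y) * T0 x = ip x y *: 1.

Local Notation "x ^st" := (star x) (at level 2, format "x ^st").
Local Notation T t := (T0 (e t)).
Local Notation Q := (Q0 e star T0).

Lemma semilin_star : semilin true star.
Proof. by move=> z x y; rewrite (starD D_cstar) (starZ D_cstar). Qed.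

Lemma star1 : star 1 = 1.
Proof.
have := starM D_cstar (star 1) 1.
by rewrite mulr1 !(starK D_cstar) mulr1 => <-.
Qed.

Lemma star_sum (I : finType) (f : I -> D) :
  star (\sum_i f i) = \sum_i star (f i).
Proof.
have := semilin_sumZ (fun=> 1) f semilin_star.
rewrite /= (eq_bigr _ (fun i _ => scale1r (f i))) => ->.
by apply: eq_bigr => i _; rewrite rmorph1 scale1r.
Qed.

Lemma scalar_inj (z z' : R[i]) : z *: (1 : D) = z' *: 1 -> z = z'.
Proof.
move=> /eqP; rewrite -subr_eq0 -scalerBl scaler_eq0 oner_eq0 orbF subr_eq0.
by move/eqP.
Qed.

Lemma starT_T s t : (T s)^st * T t = (s == t)%:R *: 1.
Proof. by rewrite T0_isometry (dot_basis e_basis) eq_sym. Qed.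

Lemma Q0_T x : Q * T0 x = T0 x.
Proof.
rewrite {2}(basis_expansion e_basis x) linear_sum mulr_suml.
apply: eq_bigr => t _.
by rewrite -mulrA T0_isometry linearZ -scalerAr mulr1.
Qed.

Lemma Q0_star : Q^st = Q.
Proof.
rewrite star_sum; apply: eq_bigr => t _.
by rewrite (starM D_cstar) (starK D_cstar).
Qed.

Lemma starT_Q0 x : (T0 x)^st * Q = (T0 x)^st.
Proof. by rewrite -{1}Q0_star -(starM D_cstar) Q0_T. Qed.

Lemma ketE w : Q * w = w -> w = \sum_t T t * ((T t)^st * w).
Proof.
move=> {1}<-; rewrite mulr_suml.
by apply: eq_bigr => t _; rewrite mulrA.
Qed.

Lemma braE w : w * Q = w -> w = \sum_t w * T t * (T t)^st.
Proof.
move=> {1}<-; rewrite mulr_sumr.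
by apply: eq_bigr => t _; rewrite mulrA.
Qed.

(** Since [Q] need not be 1, left multiplication by the [(T t)^st] only sees the part of an element
    under [Q]; hence the two invariance premises, checked anew for each leg of each equation. *)
Lemma ket_ext w w' : Q * w = w -> Q * w' = w' ->
  (forall t, (T t)^st * w = (T t)^st * w') -> w = w'.
Proof.
move=> qw qw' ww'; rewrite (ketE qw) (ketE qw').
by apply: eq_bigr => t _; rewrite ww'.
Qed.

Lemma bra_ext w w' : w * Q = w -> w' * Q = w' ->
  (forall t, w * T t = w' * T t) -> w = w'.
Proof.
move=> qw qw' ww'; rewrite (braE qw) (braE qw').
by apply: eq_bigr => t _; rewrite ww'.
Qed.

Lemma bra_ket (f h : L -> R[i]) :
  (\sum_q f q *: (T q)^st) * (\sum_q h q *: T q) = (\sum_q f q * h q) *: 1.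
Proof.
rewrite mulr_suml scaler_suml; apply: eq_bigr => q _.
rewrite mulr_sumr (bigD1 q) //= big1 => [|q' /negPf qq'].
  by rewrite -scalerAl -scalerAr starT_T eqxx scale1r scalerA addr0.
by rewrite -scalerAl -scalerAr starT_T eq_sym qq' scale0r !scaler0.
Qed.

Section KKKstar.
Variable w : D.
Hypothesis w_range : KKKstar star T0 w.

Lemma KKKstar_ket : Q * w = w.
Proof.
case: w_range => l ->; rewrite mulr_sumr; apply: eq_bigr => p _.
by rewrite -scalerAr !mulrA Q0_T.
Qed.

Lemma KKKstar_ket2 x : Q * ((T0 x)^st * w) = (T0 x)^st * w.
Proof.
case: w_range => l ->; rewrite !mulr_sumr; apply: eq_bigr => p _.
rewrite -!scalerAr -[_ * _ * star _]mulrA [(T0 x)^st * _]mulrA T0_isometry.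
by rewrite -scalerAl mul1r -scalerAr mulrA Q0_T.
Qed.

Lemma KKKstar_bra : w * Q = w.
Proof.
case: w_range => l ->; rewrite mulr_suml; apply: eq_bigr => p _.
by rewrite -scalerAl -!mulrA starT_Q0.
Qed.

End KKKstar.

Section Coefficients.
Variables (G : finZmodType) (B : G -> {linear K0 -> D}).
Hypothesis B_range : forall g x, KKKstar star T0 (B g x).
Local Notation b := (bcoef star T0 e B).

Lemma coef_full g r s t u :
  (T s)^st * (T r)^st * B g (e u) * T t = b g r s t u *: 1.
Proof. by rewrite (bcoefE T0_isometry). Qed.

Lemma coef_ket g r t u :
  (T r)^st * B g (e u) * T t = \sum_s b g r s t u *: T s.
Proof.
rewrite (ketE (KKKstar_ket2 (B_range g (e u)) (e r))) mulr_suml.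
apply: eq_bigr => s _.
by rewrite !mulrA -!(mulrA (T s)) coef_full -scalerAr mulr1.
Qed.

Lemma coef_bra g r s u :
  (T s)^st * (T r)^st * B g (e u) = \sum_t b g r s t u *: (T t)^st.
Proof.
rewrite -(KKKstar_bra (B_range g (e u))) !mulrA mulr_sumr.
by apply: eq_bigr => t _; rewrite mulrA coef_full -scalerAl mul1r.
Qed.

Lemma coef_ket2 g t u :
  B g (e u) * T t = \sum_r \sum_s b g r s t u *: (T r * T s).
Proof.
rewrite {1}(ketE (KKKstar_ket (B_range g (e u)))) mulr_suml.
apply: eq_bigr => r _; rewrite -!mulrA (mulrA (T r)^st) coef_ket mulr_sumr.
by apply: eq_bigr => s _; rewrite scalerAr.
Qed.

Lemma coef_star g r s t u :
  (T t)^st * (B g (e u))^st * T r * T s = (b g r s t u)^* *: 1.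
Proof.
have := congr1 star (coef_full g r s t u).
by rewrite !(starM D_cstar, starZ D_cstar, starK D_cstar) star1 !mulrA => <-.
Qed.

Lemma coef_star_bra g r t u :
  (T t)^st * (B g (e u))^st * T r = \sum_s (b g r s t u)^* *: (T s)^st.
Proof.
have := congr1 star (coef_ket g r t u).
rewrite !(starM D_cstar, starK D_cstar) star_sum !mulrA => ->.
by apply: eq_bigr => s _; rewrite (starZ D_cstar).
Qed.

Lemma coef_star_ket g r s u :
  (B g (e u))^st * T r * T s = \sum_t (b g r s t u)^* *: T t.
Proof.
have := congr1 star (coef_bra g r s u).
rewrite !(starM D_cstar, starK D_cstar) star_sum !mulrA => ->.
by apply: eq_bigr => t _; rewrite (starZ D_cstar) (starK D_cstar).
Qed.

Lemma T0_injective : injective T0.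
Proof. exact: (T0_inj T0_isometry). Qed.

(** [T0inv] is 0 off the image of [T0], so a preimage must be exhibited: the scalars [z t] are its
    coordinates. *)
Lemma T0inv_ket w :
  Q * w = w -> (forall t, exists z : R[i], (T t)^st * w = z *: 1) ->
  T0 (T0inv T0 w) = w.
Proof.
move=> qw /choice[z zP].
have -> : w = T0 (\sum_t z t *: e t).
  rewrite (ketE qw) linear_sum; apply: eq_bigr => t _.
  by rewrite zP linearZ -scalerAr mulr1.
by rewrite (T0invK T0_isometry).
Qed.

Lemma KKKstar_sandwich w x y z : KKKstar star T0 w ->
  exists v : R[i], (T0 z)^st * ((T0 x)^st * w * T0 y) = v *: 1.
Proof.
move=> [l ->]; elim: l => [|p l [v IH]].
  by exists 0; rewrite big_nil !(mulr0, mul0r) scale0r.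
exists (p.1 * (ip p.2.1.1 x * (ip p.2.1.2 z * ip y p.2.2)) + v).
rewrite big_cons mulrDr mulrDl mulrDr IH scalerDl; congr (_ + _).
rewrite -scalerAr -scalerAl -scalerAr -!scalerA; congr (_ *: _).
rewrite !mulrA -(mulrA _ (T0 x)^st) T0_isometry -!scalerAr !mulr1 -!scalerAl.
by rewrite T0_isometry -!scalerAl mul1r T0_isometry.
Qed.

Lemma T0inv_sandwich g x y z :
  T0 (T0inv T0 ((T0 x)^st * B g y * T0 z)) = (T0 x)^st * B g y * T0 z.
Proof.
apply: T0inv_ket => [|t].
  by rewrite !mulrA -(mulrA Q) KKKstar_ket2.
exact: KKKstar_sandwich.
Qed.

Lemma T0inv_star_sandwich g x y z :
  T0 (T0inv T0 ((B g y)^st * T0 x * T0 z)) = (B g y)^st * T0 x * T0 z.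
Proof.
apply: T0inv_ket => [|t].
  by rewrite !mulrA -{1}Q0_star -(starM D_cstar) KKKstar_bra.
have [v] := KKKstar_sandwich x (e t) z (B_range g y).
move=> /(congr1 star).
rewrite !(starM D_cstar, starZ D_cstar, starK D_cstar) star1 => vP.
by exists v^*; rewrite -vP !mulrA.
Qed.

Lemma T0inv_coef g r t u :
  T0inv T0 ((T r)^st * B g (e u) * T t) = \sum_s b g r s t u *: e s.
Proof.
apply: T0_injective; rewrite T0inv_sandwich coef_ket linear_sum.
by apply: eq_bigr => s _; rewrite linearZ.
Qed.

Lemma T0inv_coef_star g r s u :
  T0inv T0 ((B g (e u))^st * T r * T s) = \sum_t (b g r s t u)^* *: e t.
Proof.
apply: T0_injective; rewrite T0inv_star_sandwich coef_star_ket linear_sum.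
by apply: eq_bigr => t _; rewrite linearZ.
Qed.

End Coefficients.
End Cuntz.

(** * The operator equations in coefficients *)

Section Fourier.
Variables (R : realType) (G : finZmodType) (pair : G -> G -> R[i]).

(* Locked: otherwise unification unfolds it while rewriting with [mulrA]. *)
Definition fourier (f : G -> R[i]) (k : G) : R[i] :=
  locked ((sqrtn R G)^-1 * \sum_(h : G) (pair k h)^* * f h).

Lemma fourierE f k :
  fourier f k = (sqrtn R G)^-1 * \sum_(h : G) (pair k h)^* * f h.
Proof. by rewrite /fourier -lock. Qed.

End Fourier.

Section Equations.
Variables (R : realType) (G : finZmodType) (m : nat) (eps : R[i]).
Variables (pair : G -> G -> R[i]) (K0 : vectType R[i]).
Variables (ip : {dot K0 for (@conjC R[i])}).
Variables (A : G -> 'End(K0)) (C : 'End(K0)) (J : K0 -> K0).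
Variables (L : finType) (e : L -> K0) (bar : L -> L).
Variables (a : G -> R[i]) (chi : L -> G -> R[i]) (c epsL : L -> R[i]).
Variables (D : algType R[i]) (star : D -> D) (nrm : D -> R).
Variables (T0 : {linear K0 -> D}) (B : G -> {linear K0 -> D}).
Hypothesis e_basis : orthonormal_basis ip e.
Hypothesis J_antilinear : semilin true J.
Hypothesis barK : involutive bar.
Hypothesis A_diag : forall g t, A g (e t) = (a g * chi t g) *: e t.
Hypothesis C_diag : forall t, C (e t) = c t *: e t.
Hypothesis J_diag : forall t, J (e t) = epsL t *: e (bar t).
Hypothesis c_bar : forall t, c (bar t) = c t.
Hypothesis epsL_real : forall t, (epsL t)^* = epsL t.
Hypothesis D_cstar : cstar_algebra star nrm.
Hypothesis T0_isometry : forall x y, star (T0 y) * T0 x = ip x y *: 1.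
Hypothesis B_range : forall g x, KKKstar star T0 (B g x).

Local Notation d := (dconst R G m).
Local Notation sqn := (sqrtn R G).
Local Notation n := (#|G|%:R : R[i]).
Local Notation "x ^st" := (star x) (at level 2, format "x ^st").
Local Notation Cst := (adjoint ip C).
Local Notation Ast g := (adjoint ip (A g)).
Local Notation T t := (T0 (e t)).
Local Notation Q := (Q0 e star T0).
Local Notation b := (bcoef star T0 e B).
Local Notation hat := (hatB pair B).

Lemma Cst_diag t : Cst (e t) = (c t)^* *: e t.
Proof. exact: (adjoint_diag e_basis C_diag). Qed.

Lemma Ast_diag g t : Ast g (e t) = (a g * chi t g)^* *: e t.
Proof. exact: (adjoint_diag e_basis (A_diag g)). Qed.

Lemma alg_scalel (z : R[i]) (x y : D) : z *: x * y = z *: (x * y).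
Proof. by rewrite scalerAl. Qed.

Lemma alg_scaler (z : R[i]) (x y : D) : x * (z *: y) = z *: (x * y).
Proof. by rewrite scalerAr. Qed.

Lemma J_scale z x : J (z *: x) = z^* *: J x.
Proof. exact: (semilinZ _ _ J_antilinear). Qed.

Lemma star_scale z x : star (z *: x) = z^* *: star x.
Proof. exact: (starZ D_cstar). Qed.

Lemma T0_scale z x : T0 (z *: x) = z *: T0 x.
Proof. exact: linearZ. Qed.

Lemma lfun_scale (X : 'End(K0)) z x : X (z *: x) = z *: X x.
Proof. exact: linearZ. Qed.

Lemma B_scale g z x : B g (z *: x) = z *: B g x.
Proof. exact: linearZ. Qed.

Definition diagE := (J_diag, Cst_diag, Ast_diag, C_diag, A_diag,
  J_scale, lfun_scale, T0_scale, B_scale, star_scale).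

Local Notation hb g r s t u := (fourier pair (fun h => b h r s t u) g).

Lemma semilin_hatB g : semilin false (hat g).
Proof.
apply: semilin_scale; apply: semilin_sum => h; apply: semilin_scale.
exact: semilin_linear.
Qed.

HB.instance Definition _ g :=
  GRing.isLinear.Build R[i] K0 D *:%R (hat g) (semilin_hatB g).

(** Gives the transform the same type as [B], so that every coefficient lemma proved for [B] also
    applies to it. *)
Definition hatB_linear g : {linear K0 -> D} := hat g.

Lemma KKKstarZ z w : KKKstar star T0 w -> KKKstar star T0 (z *: w).
Proof.
move=> [s ->]; exists [seq (z * p.1, p.2) | p <- s].
by rewrite big_map scaler_sumr; apply: eq_bigr => p _; rewrite scalerA.
Qed.

Lemma KKKstar_sum (I : finType) (w : I -> D) :
  (forall i, KKKstar star T0 (w i)) -> KKKstar star T0 (\sum_i w i).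
Proof.
move=> wP; elim/big_rec: _ => [|i x _ [s ->]].
  by exists [::]; rewrite big_nil.
by have [s' ->] := wP i; exists (s' ++ s); rewrite big_cat.
Qed.

Lemma hatB_range g x : KKKstar star T0 (hatB_linear g x).
Proof. by apply/KKKstarZ/KKKstar_sum => h; apply/KKKstarZ. Qed.

Lemma hat_full g r s t u :
  (T s)^st * (T r)^st * hat g (e u) * T t = hb g r s t u *: 1.
Proof.
rewrite fourierE /hatB -scalerAr -scalerAl -scalerA mulr_sumr mulr_suml.
congr (_ *: _).
rewrite scaler_suml; apply: eq_bigr => h _.
by rewrite -scalerAr -scalerAl (coef_full _ T0_isometry) // scalerA.
Qed.

Lemma hatB_coef g r s t u :
  bcoef star T0 e hatB_linear g r s t u = hb g r s t u.
Proof.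
apply: (@scalar_inj _ D); rewrite -hat_full.
by rewrite -(coef_full _ T0_isometry hatB_range).
Qed.

Lemma semilin_scale_dotl bb (V : lmodType R[i]) (k : R[i]) (w : V) y
    (f : K0 -> K0) :
  semilin bb f -> semilin bb (fun x => (k * ip (f x) y) *: w).
Proof.
move=> sf z x x'; rewrite sf linearPl mulrDr scalerDl scalerA.
by rewrite /= mulrCA.
Qed.

Lemma semilin_scale_dotr bb (V : lmodType R[i]) (k : R[i]) (w : V) x
    (f : K0 -> K0) :
  semilin (~~ bb) f -> semilin bb (fun y => (k * ip x (f y)) *: w).
Proof.
move=> sf z y y'; rewrite sf linearPr mulrDr scalerDl scalerA /= mulrCA.
by congr ((_ * _) *: _ + _); case: bb {sf}; rewrite /conj_if //= conjCK.
Qed.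

Lemma semilin_T0inv bb (V : lmodType R[i]) (f : V -> D) :
  (forall x, T0 (T0inv T0 (f x)) = f x) -> semilin bb f ->
  semilin bb (fun x => T0inv T0 (f x)).
Proof.
move=> fK sf z x y; apply: (T0_injective T0_isometry).
by rewrite fK sf linearP /= !fK.
Qed.

(** The last clause, a linear map applied to anything, is generic, so the constructions with their
    own rule come before it. The [T0inv] clause also proves that the argument lies in the image of
    [T0]. *)
Ltac semilin_step := match goal with
  | |- semilin _ (hatB _ _ _) => exact: semilin_hatB
  | |- semilin _ (@GRing.Linear.sort _ _ _ _ _) => exact: semilin_linear
  | |- semilin _ (@fun_of_lfun _ _ _ _) => exact: semilin_linear
  | |- semilin _ J => exact: J_antilinear
  | |- semilin _ (fun x => x) => exact: semilin_id
  | |- semilin _ (fun x => T0inv _ _) => apply: semilin_T0inv =>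
      [?|]; [first [exact: (T0inv_sandwich e_basis T0_isometry B_range)
        | exact: (T0inv_star_sandwich e_basis D_cstar T0_isometry B_range)]|]
  | |- semilin _ (fun x => - _) => apply: semilinN
  | |- semilin _ (fun x => \sum_i _) => apply: semilin_sum => ?
  | |- semilin _ (fun x => _ + _) => apply: semilinD
  | |- semilin _ (fun x => _ *: _) =>
      first [apply: semilin_scale | apply: semilin_scale_dotl
            | apply: semilin_scale_dotr]
  | |- semilin _ (fun x => ?w * _) => apply: (semilin_mull w)
  | |- semilin _ (fun x => _ * ?w) => apply: (semilin_mulr w)
  | |- semilin _ (fun x => hatB _ _ _ _) => apply: (semilin_lin (hatB_linear _))
  | |- semilin _ (fun x => star _) =>
      apply: (semilin_anti (semilin_star D_cstar))
  | |- semilin _ (fun x => J _) => apply: (semilin_anti J_antilinear)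
  | |- semilin _ (fun x => _ _) => apply: semilin_lin
  end.
Ltac semilin_tac := repeat semilin_step.

(** * Translation of the single operator equations *)

Lemma E1_coef :
  E1 m pair ip C J e star T0 B <->
  forall t u, \sum_s epsL s * hb 0 s (bar s) t u
              = - (d^-1 * (epsL u * c u * (bar u == t)%:R)).
Proof.
have lhs t u : (\sum_s (T0 (J (e s)))^st * (T s)^st * hat 0 (e u)) * T t
    = (\sum_s epsL s * hb 0 s (bar s) t u) *: 1.
  rewrite mulr_suml scaler_suml; apply: eq_bigr => s _.
  rewrite !diagE !alg_scalel hat_full epsL_real.
  by rewrite scalerA.
have rhs t u : - (d^-1 *: (T0 (Cst (J (e u))))^st) * T t
    = - (d^-1 * (epsL u * c u * (bar u == t)%:R)) *: 1.
  rewrite !diagE conjCK c_bar epsL_real.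
  rewrite scaleNr mulNr !alg_scalel (starT_T e_basis T0_isometry) !scalerA.
  by rewrite !mulrA.
split=> [E t u|F].
  by apply: (@scalar_inj _ D); rewrite -lhs -rhs E.
apply: (semilin_ext e_basis (b := false)) => [||u];
  [by semilin_tac|by semilin_tac|].
apply: (bra_ext (e := e) (star := star) (T0 := T0)) => [||t];
  last by rewrite lhs rhs F.
  rewrite mulr_suml; apply: eq_bigr => s _.
  rewrite -mulrA (KKKstar_bra e_basis D_cstar T0_isometry) //.
  exact: hatB_range.
by rewrite mulNr alg_scalel (starT_Q0 e_basis D_cstar T0_isometry).
Qed.

Let TsT := starT_T e_basis T0_isometry.
Let B_bra g x := KKKstar_bra e_basis D_cstar T0_isometry (B_range g x).
Let hat_bra g x : hat g x * Q = hat g x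
  := KKKstar_bra e_basis D_cstar T0_isometry (hatB_range g x).
Let B_ket g x := KKKstar_ket e_basis T0_isometry (B_range g x).
Let B_ket2 g x := KKKstar_ket2 e_basis T0_isometry (B_range g x).
Let QT := Q0_T e_basis T0_isometry.
Let TQ := starT_Q0 e_basis D_cstar T0_isometry.

Lemma hat_ket2 g t u :
  hat g (e u) * T t = \sum_r \sum_s hb g r s t u *: (T r * T s).
Proof.
rewrite [LHS](coef_ket2 e_basis T0_isometry hatB_range).
by apply: eq_bigr => r _; apply: eq_bigr => s _; rewrite hatB_coef.
Qed.

Lemma hat_star g r s t u :
  (T t)^st * (hat g (e u))^st * T r * T s = (hb g r s t u)^* *: 1.
Proof.
by rewrite [LHS](coef_star e D_cstar T0_isometry hatB_range) hatB_coef.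
Qed.

Lemma hat_coef_bra g r s u :
  (T s)^st * (T r)^st * hat g (e u) = \sum_t hb g r s t u *: (T t)^st.
Proof.
rewrite [LHS](coef_bra e_basis D_cstar T0_isometry hatB_range).
by apply: eq_bigr => t _; rewrite hatB_coef.
Qed.

Lemma hat_star_ket g r s u :
  (hat g (e u))^st * T r * T s = \sum_t (hb g r s t u)^* *: T t.
Proof.
rewrite [LHS](coef_star_ket e_basis D_cstar T0_isometry hatB_range).
by apply: eq_bigr => t _; rewrite hatB_coef.
Qed.

Lemma E2_coef :
  E2 m pair ip C J e star T0 B <->
  forall h t t' u u', \sum_r \sum_s (hb h r s t' u')^* * hb h r s t u
    = (u == u')%:R / n * (t' == t)%:R
      - (h == 0)%:R / d * ((epsL u' * (c u')^* * (bar u' == t')%:R)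
                           * (epsL u * c u * (bar u == t)%:R)).
Proof.
have lhs h t t' u u' :
    (T t')^st * ((hat h (e u'))^st * hat h (e u)) * T t
    = (\sum_r \sum_s (hb h r s t' u')^* * hb h r s t u) *: 1.
  rewrite -!mulrA hat_ket2 !mulr_sumr scaler_suml; apply: eq_bigr => r _.
  rewrite !mulr_sumr scaler_suml; apply: eq_bigr => s _.
  by rewrite !alg_scaler !mulrA hat_star scalerA mulrC.
have rhs h t t' u u' :
    (T t')^st * ((ip (e u) (e u') / n) *: Q
      - ((h == 0)%:R / d) *: (T0 (Cst (J (e u'))) * (T0 (Cst (J (e u))))^st))
      * T t
    = ((u == u')%:R / n * (t' == t)%:R
      - (h == 0)%:R / d * ((epsL u' * (c u')^* * (bar u' == t')%:R)
                           * (epsL u * c u * (bar u == t)%:R))) *: 1.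
  rewrite !diagE !conjCK !c_bar !epsL_real mulrBr mulrBl scalerBl.
  rewrite (dot_basis e_basis) !(alg_scaler, alg_scalel).
  rewrite TQ TsT; congr (_ - _); first by rewrite scalerA.
  rewrite mulrA TsT -mulrA TsT alg_scalel mul1r !scalerA; congr (_ *: _).
  by rewrite [t' == _]eq_sym; ring.
split=> [E h t t' u u'|F].
  by apply: (@scalar_inj _ D); rewrite -lhs -rhs E.
move=> h xi eta; move: xi.
apply: (semilin_ext e_basis (b := false)) => [||u].
- by semilin_tac.
- apply: semilinD; last by semilin_tac.
  move=> z x y; rewrite linearPl mulrDl scalerDl; congr (_ + _).
  by rewrite /= scalerA mulrA.
move: eta; apply: (semilin_ext e_basis (b := true)) => [||u'].
- by semilin_tac.
- apply: semilinD; last by semilin_tac.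
  move=> z x y; rewrite linearPr mulrDl scalerDl; congr (_ + _).
  by rewrite /= scalerA mulrA.
apply: (ket_ext (e := e) (star := star) (T0 := T0)) => [||t'].
- by rewrite mulrA -{1}(Q0_star e T0 D_cstar) -(starM D_cstar) hat_bra.
- by rewrite mulrBr !alg_scaler !mulrA QT {2}/Q0 mulr_sumr; congr (_ *: _ - _);
     apply: eq_bigr => s _; rewrite mulrA QT.
apply: (bra_ext (e := e) (star := star) (T0 := T0)) => [||t].
- by rewrite -!mulrA hat_bra.
- rewrite -mulrA; congr (_ * _); rewrite mulrBl !alg_scalel -mulrA TQ.
  rewrite {1}/Q0 mulr_suml; congr (_ *: _ - _).
  by apply: eq_bigr => s _; rewrite -mulrA TQ.
by rewrite lhs rhs F.
Qed.

Lemma tens_diag (X Y : 'End(K0)) (x y : L -> R[i]) r s :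
  (forall t, X (e t) = x t *: e t) -> (forall t, Y (e t) = y t *: e t) ->
  (T s)^st * (T r)^st * tens_elt e star T0 X Y
  = (x r * y s) *: ((T s)^st * (T r)^st).
Proof.
move=> Xe Ye.
rewrite mulr_sumr (bigD1 r) //= [X in _ + X]big1 => [|r' /negPf rr'].
  rewrite addr0 mulr_sumr (bigD1 s) //= [X in _ + X]big1 => [|s' /negPf ss'].
    rewrite addr0 Xe Ye !T0_scale !(alg_scalel, alg_scaler) -!mulrA.
    rewrite (mulrA _ (T r)).
    rewrite TsT eqxx scale1r mul1r (mulrA _ (T s)) TsT eqxx scale1r mul1r.
    by rewrite scalerA mulrC.
  rewrite Xe Ye !T0_scale !(alg_scalel, alg_scaler) -!mulrA (mulrA _ (T r)).
  rewrite TsT eqxx scale1r mul1r (mulrA _ (T s')) TsT eq_sym ss' scale0r mul0r.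
  by rewrite !scaler0.
rewrite mulr_sumr big1 // => s' _.
rewrite Xe !T0_scale !(alg_scalel, alg_scaler) -!mulrA (mulrA _ (T r')).
by rewrite TsT eq_sym rr' scale0r mul0r mulr0 scaler0.
Qed.

Lemma op_elt_diag (X : 'End(K0)) (x : L -> R[i]) t :
  (forall t, X (e t) = x t *: e t) -> op_elt e star T0 X * T t = x t *: T t.
Proof.
move=> Xe; rewrite mulr_suml (bigD1 t) //= big1 => [|s /negPf st].
  by rewrite addr0 Xe T0_scale !alg_scalel -mulrA TsT eqxx scale1r mulr1.
by rewrite -mulrA TsT st scale0r mulr0.
Qed.

(** All operators involved are diagonal in the basis, so (E3) only multiplies each coefficient by a
    scalar: it restricts which coefficients may be nonzero. *)
Lemma E3_coef :
  E3 ip A e star T0 B <->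
  forall g h r s t u, a h * chi u h * b g r s t u
    = a h * chi r h * (a h * chi s h) * (a h * chi t h)^* * b g r s t u.
Proof.
have lhs g h r s t u : (T s)^st * ((T r)^st * B g (A h (e u))) * T t
    = (a h * chi u h * b g r s t u) *: 1.
  rewrite !diagE !(alg_scaler, alg_scalel) !mulrA.
  by rewrite (coef_full e T0_isometry B_range) scalerA.
have rhs g h r s t u : (T s)^st * ((T r)^st *
      (tens_elt e star T0 (A h) (A h) * B g (e u) * op_elt e star T0 (Ast h)))
      * T t
    = (a h * chi r h * (a h * chi s h) * (a h * chi t h)^* * b g r s t u) *: 1.
  rewrite !mulrA -[_ * T t]mulrA (op_elt_diag _ (Ast_diag h)).
  rewrite (tens_diag _ _ (A_diag h) (A_diag h)) !(alg_scaler, alg_scalel).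
  rewrite (coef_full e T0_isometry B_range) !scalerA; congr (_ *: _).
  ring.
split=> [E g h r s t u|F].
  by apply: (@scalar_inj _ D); rewrite -lhs -rhs E.
move=> g h; apply: (semilin_ext e_basis (b := false)) => [||u];
  [by semilin_tac|by semilin_tac|].
have tens_ket w : Q * (tens_elt e star T0 (A h) (A h) * w)
    = tens_elt e star T0 (A h) (A h) * w.
  rewrite mulrA; congr (_ * _); rewrite mulr_sumr; apply: eq_bigr => s _.
  by rewrite mulr_sumr; apply: eq_bigr => t _; rewrite !mulrA QT.
have tens_ket2 r w : Q * ((T r)^st * (tens_elt e star T0 (A h) (A h) * w))
    = (T r)^st * (tens_elt e star T0 (A h) (A h) * w).
  rewrite !mulrA; congr (_ * _); rewrite !mulr_sumr; apply: eq_bigr => s _.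
  rewrite !mulr_sumr; apply: eq_bigr => t _.
  rewrite !mulrA -(mulrA Q) T0_isometry alg_scaler mulr1.
  by rewrite !alg_scalel mul1r QT.
apply: (ket_ext (e := e) (star := star) (T0 := T0)) => [||r].
- exact: B_ket.
- by rewrite -!mulrA tens_ket.
apply: (ket_ext (e := e) (star := star) (T0 := T0)) => [||s].
- exact: B_ket2.
- by rewrite -!mulrA tens_ket2.
apply: (bra_ext (e := e) (star := star) (T0 := T0)) => [||t].
- by rewrite -!mulrA B_bra.
- rewrite -!mulrA; do 4!congr (_ * _); rewrite mulr_suml.
  by apply: eq_bigr => q _; rewrite -mulrA TQ.
by rewrite lhs rhs F.
Qed.

Lemma sum_delta (I : finType) (V : lmodType R[i]) (f : I -> V) j :
  \sum_i (j == i)%:R *: f i = f j.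
Proof.
rewrite (bigD1 j) //= big1 => [|i /negPf ij].
  by rewrite eqxx scale1r addr0.
by rewrite eq_sym ij scale0r.
Qed.

Let bar_eq s t : (bar s == t) = (s == bar t) := inv_eq barK s t.

Lemma B_star_bra g x : Q * (B g x)^st = (B g x)^st.
Proof. by rewrite -{1}(Q0_star e T0 D_cstar) -(starM D_cstar) B_bra. Qed.

Lemma B_star_ket2 g x y : (B g x)^st * T0 y * Q = (B g x)^st * T0 y.
Proof.
have := congr1 star (B_ket2 g x y).
by rewrite !(starM D_cstar, starK D_cstar) (Q0_star e T0 D_cstar).
Qed.

Lemma B_star_ket g x : (B g x)^st * Q = (B g x)^st.
Proof. by rewrite -{1}(Q0_star e T0 D_cstar) -(starM D_cstar) B_ket. Qed.

Lemma E4_coef :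
  E4 eps A J e star T0 B <->
  forall g r s t u, (b g r s t u)^*
    = eps * (epsL u * (a (- g) * chi (bar u) (- g)) * epsL (bar s)
             * b (- g) t (bar s) r (bar u)).
Proof.
have lhs g r s t u : (T t)^st * (B g (e u))^st * T r * T s
    = (b g r s t u)^* *: 1.
  exact: (coef_star e D_cstar T0_isometry B_range).
have term g s' t' r s t u : (T t)^st * (T s' * (T (bar t'))^st * (T t')^st
      * (T s')^st * B g (e u)) * T r * T s
    = ((t == s')%:R * (bar t' == s)%:R * b g s' t' r u) *: 1.
  transitivity ((T t)^st * T s' * (T (bar t'))^st
    * ((T t')^st * (T s')^st * B g (e u) * T r) * T s); first by rewrite !mulrA.
  rewrite (coef_full e T0_isometry B_range) TsT !(alg_scalel, alg_scaler).
  by rewrite mul1r mulr1 TsT !scalerA; congr (_ *: _); ring.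
have rhs g r s t u : (T t)^st * (eps *: \sum_s' \sum_t'
      T s' * (T0 (J (e t')))^st * (T t')^st * (T s')^st
      * B (- g) (A (- g) (J (e u)))) * T r * T s
    = (eps * (epsL u * (a (- g) * chi (bar u) (- g)) * epsL (bar s)
             * b (- g) t (bar s) r (bar u))) *: 1.
  rewrite alg_scaler !alg_scalel -scalerA; congr (_ *: _).
  rewrite !(mulr_sumr, mulr_suml).
  (* Writing the target as a sum against deltas allows a termwise comparison; the surviving term is
     [s' = t], [t' = bar s]. *)
  rewrite -[RHS](sum_delta (fun s' => (epsL u * (a (- g) * chi (bar u) (- g))
    * epsL (bar s) * b (- g) s' (bar s) r (bar u)) *: (1 : D))).
  apply: eq_bigr => s' _.
  rewrite !(mulr_sumr, mulr_suml).
  rewrite -[RHS](sum_delta (fun t' => (t == s')%:R *: ((epsL u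
    * (a (- g) * chi (bar u) (- g)) * epsL t' * b (- g) s' t' r (bar u))
    *: (1 : D))) (bar s)).
  apply: eq_bigr => t' _.
  rewrite !diagE epsL_real !(alg_scalel, alg_scaler) term !scalerA.
  by rewrite bar_eq [t' == _]eq_sym; congr (_ *: _); ring.
split=> [E g r s t u|F].
  by apply: (@scalar_inj _ D); rewrite -lhs -rhs E.
move=> g; apply: (semilin_ext e_basis (b := true)) => [||u];
  [by semilin_tac|by semilin_tac|].
have fullE s t r g' u' : (T t)^st * ((T s)^st * (B g' (e u') * T r))
   = b g' s t r u' *: 1.
  by rewrite !mulrA (coef_full e T0_isometry B_range).
have fullEx s t r g' u' x : (T t)^st * ((T s)^st * (B g' (e u') * (T r * x)))
   = b g' s t r u' *: x.
  by rewrite !mulrA (coef_full e T0_isometry B_range) alg_scalel mul1r.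
(* The adjoint of an element of the range of [B g] has one isometry on the left and two adjoints on
   the right, hence one test from the left and two from the right. *)
apply: (ket_ext (e := e) (star := star) (T0 := T0)) => [||t].
- exact: B_star_bra.
- rewrite alg_scaler mulr_sumr; congr (_ *: _); apply: eq_bigr => s _.
  by rewrite mulr_sumr; apply: eq_bigr => t _; rewrite !mulrA QT.
apply: (bra_ext (e := e) (star := star) (T0 := T0)) => [||r].
- by rewrite -mulrA B_star_ket.
- rewrite -mulrA; congr (_ * _); rewrite alg_scalel mulr_suml.
  congr (_ *: _); apply: eq_bigr => s _.
  by rewrite mulr_suml; apply: eq_bigr => t' _; rewrite -mulrA B_bra.
apply: (bra_ext (e := e) (star := star) (T0 := T0)) => [||s].
- by rewrite -!mulrA; congr (_ * _); rewrite mulrA B_star_ket2.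
- rewrite -!mulrA; congr (_ * _); rewrite !alg_scalel !mulr_suml.
  congr (_ *: _); apply: eq_bigr => s _.
  rewrite !mulr_suml; apply: eq_bigr => t' _.
  rewrite !diagE !(alg_scaler, alg_scalel) -!mulrA fullEx.
  by rewrite fullE !(alg_scaler, alg_scalel) mulr1 TQ.
by rewrite lhs rhs F.
Qed.

(** The inner factor of (E5) is a scalar, so its right-hand side is already an expansion in products
    [T r * T s * (T t)^st], and the coefficients can be read off. *)
Lemma E5_coef :
  E5 eps pair A C J e star T0 B <->
  forall g r s t u, hb g r s t u
    = eps * (a (- g) * chi u (- g) * c u * epsL (bar r) * epsL (bar t)
             * b (- g) s (bar t) (bar r) u).
Proof.
have term g u s' t' r' : (T t')^st * (T s')^st * B (- g) (A (- g) (C (e u)))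
      * T r' * T0 (J (e r')) * T s' * (T0 (J (e t')))^st
    = (a (- g) * chi u (- g) * c u * epsL r' * epsL t' * b (- g) s' t' r' u)
      *: (T (bar r') * T s' * (T (bar t'))^st).
  rewrite !diagE epsL_real !(alg_scaler, alg_scalel).
  rewrite (coef_full e T0_isometry B_range) !(alg_scaler, alg_scalel) mul1r.
  by rewrite !scalerA; congr (_ *: _); ring.
have rhs g r s t u : (T s)^st * ((T r)^st * (eps *: \sum_s' \sum_t' \sum_r'
      ((T t')^st * (T s')^st * B (- g) (A (- g) (C (e u))) * T r')
      * T0 (J (e r')) * T s' * (T0 (J (e t')))^st)) * T t
    = (eps * (a (- g) * chi u (- g) * c u * epsL (bar r) * epsL (bar t)
             * b (- g) s (bar t) (bar r) u)) *: 1.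
  rewrite !alg_scaler !alg_scalel -scalerA; congr (_ *: _).
  rewrite !(mulr_sumr, mulr_suml).
  rewrite -[RHS](sum_delta (fun s' => (a (- g) * chi u (- g) * c u
    * epsL (bar r) * epsL (bar t) * b (- g) s' (bar t) (bar r) u) *: (1 : D))).
  apply: eq_bigr => s' _; rewrite !(mulr_sumr, mulr_suml).
  rewrite -[RHS](sum_delta (fun t' => (s == s')%:R *: ((a (- g) * chi u (- g)
    * c u * epsL (bar r) * epsL t' * b (- g) s' t' (bar r) u) *: (1 : D)))
    (bar t)).
  apply: eq_bigr => t' _; rewrite !(mulr_sumr, mulr_suml).
  rewrite -[RHS](sum_delta (fun r' => (bar t == t')%:R *: ((s == s')%:R *:
    ((a (- g) * chi u (- g) * c u * epsL r' * epsL t' * b (- g) s' t' r' u)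
    *: (1 : D)))) (bar r)).
  apply: eq_bigr => r' _.
  rewrite term !(alg_scaler, alg_scalel) !mulrA -(mulrA (T s)^st) TsT.
  rewrite !(alg_scaler, alg_scalel) mulr1 TsT !alg_scalel mul1r TsT !scalerA.
  by rewrite !bar_eq [t' == _]eq_sym bar_eq; congr (_ *: _); ring.
split=> [E g r s t u|F].
  by apply: (@scalar_inj _ D); rewrite -rhs -E -hat_full !mulrA.
move=> g; apply: (semilin_ext e_basis (b := false)) => [||u];
  [by semilin_tac|by semilin_tac|].
apply: (ket_ext (e := e) (star := star) (T0 := T0)) => [||r].
- exact: (KKKstar_ket e_basis T0_isometry (hatB_range g (e u))).
- rewrite alg_scaler mulr_sumr; congr (_ *: _); apply: eq_bigr => s _.
  rewrite mulr_sumr; apply: eq_bigr => t _; rewrite mulr_sumr.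
  by apply: eq_bigr => r _; rewrite term !alg_scaler !mulrA QT.
apply: (ket_ext (e := e) (star := star) (T0 := T0)) => [||s].
- exact: (KKKstar_ket2 e_basis T0_isometry (hatB_range g (e u))).
- rewrite !alg_scaler !mulr_sumr; congr (_ *: _); apply: eq_bigr => s _.
  rewrite !mulr_sumr; apply: eq_bigr => t _; rewrite !mulr_sumr.
  apply: eq_bigr => r' _; rewrite term !alg_scaler -!mulrA (mulrA (T r)^st) TsT.
  by rewrite !alg_scalel !alg_scaler mul1r !mulrA QT.
apply: (bra_ext (e := e) (star := star) (T0 := T0)) => [||t].
- by rewrite -!mulrA hat_bra.
- rewrite -!mulrA; do 2!congr (_ * _).
  rewrite !alg_scalel mulr_suml; congr (_ *: _); apply: eq_bigr => s' _.
  rewrite mulr_suml; apply: eq_bigr => t _; rewrite mulr_suml.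
  by apply: eq_bigr => r' _; rewrite term !alg_scalel -!mulrA TQ.
by rewrite rhs -F !mulrA hat_full.
Qed.

Lemma QQ : Q * Q = Q.
Proof.
by rewrite {2 3}/Q0 mulr_sumr; apply: eq_bigr => s _; rewrite mulrA QT.
Qed.

Lemma Q0Q0E : Q0Q0 e star T0 = \sum_s T s * Q * (T s)^st.
Proof.
apply: eq_bigr => s _; rewrite mulr_sumr mulr_suml.
by apply: eq_bigr => t _; rewrite !mulrA.
Qed.

Lemma starT_Q0Q0 r : (T r)^st * Q0Q0 e star T0 = Q * (T r)^st.
Proof.
rewrite Q0Q0E mulr_sumr -[RHS](sum_delta (fun s => Q * (T s)^st)).
by apply: eq_bigr => s _; rewrite !mulrA TsT !alg_scalel mul1r.
Qed.

Lemma Q0Q0_T r : Q0Q0 e star T0 * T r = T r * Q.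
Proof.
rewrite Q0Q0E mulr_suml -[RHS](sum_delta (fun s => T s * Q)).
apply: eq_bigr => s _.
by rewrite -!mulrA TsT !alg_scaler mulr1 eq_sym.
Qed.

(** The vector of K0 tensor K0 attached to [J]. Its rank-one operator is the 1/d term of (E6), and
    it is also the left factor of the last term of (E10). *)
Definition J_vector : D := \sum_s T s * T0 (J (e s)).
Local Notation V := J_vector.

Lemma starT_J_vector r : (T r)^st * V = epsL r *: T (bar r).
Proof.
rewrite mulr_sumr -[RHS](sum_delta (fun r => epsL r *: T (bar r))).
by apply: eq_bigr => s _; rewrite mulrA TsT !diagE alg_scalel mul1r.
Qed.

Lemma Q0_J_vector : Q * V = V.
Proof. by rewrite mulr_sumr; apply: eq_bigr => s _; rewrite mulrA QT. Qed.

Lemma J_vector_starT r : V^st * T r = epsL r *: (T (bar r))^st.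
Proof.
have := congr1 star (starT_J_vector r).
by rewrite !(starM D_cstar, starK D_cstar) star_scale epsL_real.
Qed.

Lemma J_vector_Q0 : V^st * Q = V^st.
Proof. by rewrite -{1}(Q0_star e T0 D_cstar) -(starM D_cstar) Q0_J_vector. Qed.

Lemma J_vector_projE :
  \sum_s \sum_t T s * T0 (J (e s)) * (T0 (J (e t)))^st * (T t)^st = V * V^st.
Proof.
rewrite mulr_suml; apply: eq_bigr => s _.
rewrite (star_sum D_cstar) mulr_sumr; apply: eq_bigr => t _.
by rewrite (starM D_cstar) !mulrA.
Qed.

Lemma E6_coef :
  E6 m pair J e star T0 B <->
  forall g r s r' s', \sum_u \sum_t hb g r s t u * (hb g r' s' t u)^*
    = n^-1 * ((r == r')%:R * (s == s')%:R)
      - (g == 0)%:R / d * ((epsL r * (bar r == s)%:R)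
                           * (epsL r' * (bar r' == s')%:R)).
Proof.
have lhs g r s r' s' : (T s)^st * ((T r)^st *
      (\sum_u hat g (e u) * (hat g (e u))^st)) * T r' * T s'
    = (\sum_u \sum_t hb g r s t u * (hb g r' s' t u)^*) *: 1.
  rewrite !(mulr_sumr, mulr_suml) scaler_suml; apply: eq_bigr => u _.
  rewrite -(bra_ket e_basis T0_isometry) -hat_star_ket -hat_coef_bra.
  by rewrite !mulrA.
have rhs g r s r' s' : (T s)^st * ((T r)^st * (n^-1 *: Q0Q0 e star T0
      - ((g == 0)%:R / d) *: (V * V^st))) * T r' * T s'
    = (n^-1 * ((r == r')%:R * (s == s')%:R)
      - (g == 0)%:R / d * ((epsL r * (bar r == s)%:R)
                           * (epsL r' * (bar r' == s')%:R))) *: 1.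
  rewrite !mulrBr !mulrBl scalerBl !(alg_scaler, alg_scalel).
  rewrite starT_Q0Q0 (mulrA _ V) starT_J_vector.
  congr (_ - _).
    rewrite (mulrA _ Q) TQ -(mulrA (T s)^st) TsT alg_scaler mulr1 alg_scalel.
    by rewrite TsT !scalerA mulrA.
  rewrite !(alg_scaler, alg_scalel) (mulrA (T s)^st) TsT !alg_scalel mul1r.
  rewrite J_vector_starT alg_scalel TsT !scalerA [s == bar r]eq_sym.
  by congr (_ *: _); ring.
split=> [E g r s r' s'|F].
  by apply: (@scalar_inj _ D); rewrite -lhs -rhs E J_vector_projE.
move=> g; rewrite J_vector_projE.
have hatQ u : (hat g (e u))^st * Q = (hat g (e u))^st.
  rewrite -{1}(Q0_star e T0 D_cstar) -(starM D_cstar).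
  by rewrite (KKKstar_ket e_basis T0_isometry (hatB_range g (e u))).
have hatTQ u r : (hat g (e u))^st * T r * Q = (hat g (e u))^st * T r.
  have := congr1 star
    (KKKstar_ket2 e_basis T0_isometry (hatB_range g (e u)) (e r)).
  by rewrite !(starM D_cstar, starK D_cstar) (Q0_star e T0 D_cstar).
apply: (ket_ext (e := e) (star := star) (T0 := T0)) => [||r].
- rewrite mulr_sumr; apply: eq_bigr => u _; rewrite mulrA; congr (_ * _).
  exact: (KKKstar_ket e_basis T0_isometry (hatB_range g (e u))).
- rewrite mulrBr !alg_scaler mulrA Q0_J_vector; congr (_ *: _ - _).
  rewrite Q0Q0E mulr_sumr; apply: eq_bigr => s _.
  by rewrite !mulrA QT.
apply: (ket_ext (e := e) (star := star) (T0 := T0)) => [||s].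
- rewrite !mulr_sumr; apply: eq_bigr => u _; rewrite !mulrA; congr (_ * _).
  rewrite -mulrA.
  exact: (KKKstar_ket2 e_basis T0_isometry (hatB_range g (e u))).
- rewrite !mulrBr !alg_scaler starT_Q0Q0 (mulrA _ V) starT_J_vector.
  by rewrite alg_scalel alg_scaler !mulrA QT QQ.
apply: (bra_ext (e := e) (star := star) (T0 := T0)) => [||r'].
- rewrite -!mulrA; do 2!congr (_ * _); rewrite mulr_suml.
  by apply: eq_bigr => u _; rewrite -mulrA hatQ.
- rewrite -!mulrA; do 2!congr (_ * _); rewrite mulrBl !alg_scalel -mulrA.
  rewrite J_vector_Q0; congr (_ *: _ - _).
  rewrite Q0Q0E mulr_suml; apply: eq_bigr => s' _.
  by rewrite -!mulrA TQ.
apply: (bra_ext (e := e) (star := star) (T0 := T0)) => [||s'].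
- rewrite -!mulrA; do 2!congr (_ * _); rewrite !mulr_suml.
  by apply: eq_bigr => u _; rewrite -!mulrA; congr (_ * _); rewrite mulrA hatTQ.
- rewrite -!mulrA; do 2!congr (_ * _); rewrite !mulrBl !alg_scalel.
  rewrite mulrA Q0Q0_T -!mulrA (mulrA V^st) J_vector_starT alg_scalel TQ.
  by rewrite QQ.
by rewrite lhs rhs F.
Qed.

Lemma E7_coef :
  E7 m ip A C J e star T0 B <->
  forall x u, (m%:R / n - d^-1) * (x == u)%:R
    = \sum_h \sum_s \sum_t \sum_y
        (epsL s * c s * (a (- h) * chi (bar s) (- h)) * epsL t * (c t)^*)
        * (b h s y t u * b (- h) (bar s) x (bar t) y).
Proof.
have rhs x u : (T x)^st * (\sum_(h : G) \sum_s \sum_t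
      (T0 (Ast (- h) (Cst (J (e s)))))^st
      * B (- h) (T0inv T0 ((T s)^st * B h (e u) * T t))
      * T0 (Cst (J (e t))))
    = (\sum_h \sum_s \sum_t \sum_y
        (epsL s * c s * (a (- h) * chi (bar s) (- h)) * epsL t * (c t)^*)
        * (b h s y t u * b (- h) (bar s) x (bar t) y)) *: 1.
  rewrite mulr_sumr scaler_suml; apply: eq_bigr => h _.
  rewrite mulr_sumr scaler_suml; apply: eq_bigr => s _.
  rewrite mulr_sumr scaler_suml; apply: eq_bigr => t _.
  (* Expanding the vector under [T0inv] in the basis introduces the inner index [y]. *)
  rewrite (T0inv_coef e_basis T0_isometry B_range) linear_sum.
  rewrite !(mulr_sumr, mulr_suml) scaler_suml; apply: eq_bigr => y _.
  rewrite !diagE !(alg_scaler, alg_scalel) !mulrA.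
  rewrite (coef_full e T0_isometry B_range) !scalerA !epsL_real !c_bar !conjCK.
  by congr (_ *: _); ring.
have lhs x u : (T x)^st * ((m%:R / n - d^-1) *: T u)
    = ((m%:R / n - d^-1) * (x == u)%:R) *: 1.
  by rewrite alg_scaler TsT scalerA.
split=> [E x u|F].
  by apply: (@scalar_inj _ D); rewrite -lhs -rhs E.
apply: (semilin_ext e_basis (b := false)) => [||u];
  [by semilin_tac|by semilin_tac|].
apply: (ket_ext (e := e) (star := star) (T0 := T0)) => [||x].
- by rewrite alg_scaler QT.
- rewrite mulr_sumr; apply: eq_bigr => h _; rewrite mulr_sumr.
  apply: eq_bigr => s _; rewrite mulr_sumr; apply: eq_bigr => t _.
  by rewrite mulrA B_ket2.
by rewrite lhs rhs F.
Qed.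

Lemma T0inv_scale (z : R[i]) w :
  T0 (T0inv T0 w) = w -> T0inv T0 (z *: w) = z *: T0inv T0 w.
Proof.
move=> wK; apply: (T0_injective T0_isometry).
by rewrite -{1}wK -T0_scale (T0invK T0_isometry) T0_scale wK.
Qed.

Lemma T0inv_scaled_coef_star (z : R[i]) g r s u :
  T0inv T0 (z *: ((B g (e u))^st * T r * T s))
  = \sum_t (z * (b g r s t u)^*) *: e t.
Proof.
rewrite T0inv_scale; last first.
  exact: (T0inv_star_sandwich e_basis D_cstar T0_isometry B_range).
rewrite (T0inv_coef_star e_basis D_cstar T0_isometry B_range) scaler_sumr.
by apply: eq_bigr => t _; rewrite scalerA.
Qed.

Lemma T0inv_scaled_coef (z : R[i]) g r t u :
  T0inv T0 (z *: ((T r)^st * B g (e u) * T t))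
  = \sum_s (z * b g r s t u) *: e s.
Proof.
rewrite T0inv_scale; last first.
  exact: (T0inv_sandwich e_basis T0_isometry B_range).
rewrite (T0inv_coef e_basis T0_isometry B_range) scaler_sumr.
by apply: eq_bigr => s _; rewrite scalerA.
Qed.

Lemma J_sum (I : finType) (f : I -> K0) : J (\sum_i f i) = \sum_i J (f i).
Proof.
have := semilin_sumZ (fun=> 1) f J_antilinear.
rewrite /= (eq_bigr _ (fun i _ => scale1r (f i))) => ->.
by apply: eq_bigr => i _; rewrite rmorph1 scale1r.
Qed.

(** (E8) has no counterpart of its own among p1-p10, so only the passage from coefficients to
    operators is stated; likewise for (E9). *)
Lemma E8_of_coef :
  (forall g u v w x,
    (g == 0)%:R * (v == w)%:R * (x == u)%:R
      - d^-1 * (u == w)%:R * (x == v)%:R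
    = \sum_h \sum_s \sum_y
        (a h * chi w h * c w * (c y)^* * epsL y * epsL v)
        * (b h w s y u * b (g - h) (bar v) x (bar y) s)) ->
  E8 m ip A C J e star T0 B.
Proof.
move=> F g xi eta zeta.
move: xi; apply: (semilin_ext e_basis (b := false)) => [||u];
  [by semilin_tac|by semilin_tac|].
move: eta; apply: (semilin_ext e_basis (b := false)) => [||v];
  [by semilin_tac|by semilin_tac|].
move: zeta; apply: (semilin_ext e_basis (b := true)) => [||w];
  [by semilin_tac|by semilin_tac|].
apply: (ket_ext (e := e) (star := star) (T0 := T0)) => [||x].
- by rewrite mulrBr !alg_scaler !QT.
- rewrite mulr_sumr; apply: eq_bigr => h _; rewrite mulr_sumr.
  by apply: eq_bigr => s _; rewrite mulrA B_ket2.
rewrite mulrBr !alg_scaler !TsT !(dot_basis e_basis) !scalerA -scalerBl F.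
rewrite mulr_sumr scaler_suml; apply: eq_bigr => h _.
rewrite mulr_sumr scaler_suml; apply: eq_bigr => s _.
rewrite !diagE !(alg_scaler, alg_scalel) scalerA T0inv_scaled_coef_star.
(* [J] is conjugate-linear and undoes the conjugation caused by the adjoint of [B h xi]; the outcome
   is therefore a product of two unconjugated coefficients. *)
rewrite J_sum !linear_sum /= !mulr_sumr scaler_suml.
rewrite scaler_sumr; apply: eq_bigr => y _.
rewrite !diagE !(alg_scaler, alg_scalel) !mulrA.
rewrite (coef_full e T0_isometry B_range) !scalerA !epsL_real !c_bar.
rewrite !rmorphM /= !conjCK.
by congr (_ *: _); ring.
Qed.

Lemma E9_of_coef :
  (forall g k u v w y,
    eps * (a (- k) * chi w (- k) * (c y)^* * (a k * chi y k)^*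
           * b (g - k) w y v u)
    = sqn^-1 * \sum_h (pair g h)^* * ((a h * chi v h)^* * (c v)^*
        * (a g * chi u g)^* * (c u)^* * (b (h - k) v u y w)^*)) ->
  E9 eps pair ip A C star T0 B.
Proof.
move=> F g k xi eta zeta.
move: xi; apply: (semilin_ext e_basis (b := false)) => [||u];
  [by semilin_tac|by semilin_tac|].
move: eta; apply: (semilin_ext e_basis (b := false)) => [||v];
  [by semilin_tac|by semilin_tac|].
move: zeta; apply: (semilin_ext e_basis (b := true)) => [||w];
  [by semilin_tac|by semilin_tac|].
apply: (ket_ext (e := e) (star := star) (T0 := T0)) => [||y].
- by rewrite alg_scaler QT.
- rewrite alg_scaler mulr_sumr; congr (_ *: _); apply: eq_bigr => h _.
  by rewrite alg_scaler !mulrA B_star_bra.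
transitivity ((eps * (a (- k) * chi w (- k) * (c y)^* * (a k * chi y k)^*
           * b (g - k) w y v u)) *: (1 : D)).
  rewrite alg_scaler -scalerA !diagE !alg_scalel T0inv_scaled_coef.
  rewrite !linear_sum mulr_sumr /=; congr (_ *: _).
  rewrite (bigD1 y) //= big1 => [|y' /negPf yy'].
    rewrite !diagE !alg_scaler TsT eqxx addr0 scale1r !scalerA conjCK.
    by congr (_ *: _); ring.
  by rewrite !diagE !alg_scaler TsT eq_sym yy' scale0r !scaler0.
rewrite F !alg_scaler -scalerA mulr_sumr scaler_suml; congr (_ *: _).
apply: eq_bigr => h _; rewrite !diagE !(alg_scaler, alg_scalel) !mulrA.
rewrite (coef_star e D_cstar T0_isometry B_range) !scalerA.
by congr (_ *: _); ring.
Qed.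

Lemma E10_coef :
  E10 m eps pair ip A C J e star T0 B <->
  forall h k u v w p x z,
    \sum_g \sum_t \sum_y \sum_q
      (a (- g - h) * chi w (- g - h))
      * (b (- g - h) w y t u * b g p x q y * (b (g + k) v z q t)^*)
    = pair h k * (a (- h) * chi w (- h)
                  * \sum_y (b k v y p w)^* * b (- h) y x z u)
      - eps / (d * sqn) * ((c u)^* * (u == w)%:R)
        * (epsL p * (bar p == x)%:R * (epsL v * (bar v == z)%:R)).
Proof.
have lhs h k u v w p x z :
    (T x)^st * ((T p)^st * (\sum_g \sum_t
      B g (T0inv T0 ((T0 (Ast (- g - h) (e w)))^st * B (- g - h) (e u) * T t))
      * (B (g + k) (e t))^st * T v)) * T z
    = (\sum_g \sum_t \sum_y \sum_q
      (a (- g - h) * chi w (- g - h))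
      * (b (- g - h) w y t u * b g p x q y * (b (g + k) v z q t)^*)) *: 1.
  rewrite !(mulr_sumr, mulr_suml) scaler_suml; apply: eq_bigr => g _.
  rewrite !(mulr_sumr, mulr_suml) scaler_suml; apply: eq_bigr => t _.
  rewrite !diagE !alg_scalel conjCK T0inv_scaled_coef linear_sum.
  rewrite !(mulr_sumr, mulr_suml) scaler_suml; apply: eq_bigr => y _.
  rewrite !diagE !(alg_scaler, alg_scalel).
  (* Regrouped so that an expansion in the [(T q)^st] meets an expansion in the [T q]; contracting
     them with [bra_ket] produces the index [q]. *)
  transitivity ((a (- g - h) * chi w (- g - h) * b (- g - h) w y t u)
    *: ((T x)^st * (T p)^st * B g (e y) * ((B (g + k) (e t))^st * T v * T z))).
    by rewrite !mulrA.
  rewrite (coef_bra e_basis D_cstar T0_isometry B_range).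
  rewrite (coef_star_ket e_basis D_cstar T0_isometry B_range).
  rewrite (bra_ket e_basis T0_isometry) scalerA mulr_sumr; congr (_ *: _).
  by apply: eq_bigr => q _; ring.
have rhs h k u v w p x z :
    (T x)^st * ((T p)^st * (pair h k *: ((B k (Ast (- h) (e w)))^st * T v
        * B (- h) (e u))
      - (eps / (d * sqn) * ip (Cst (e u)) (e w))
        *: \sum_t T t * T0 (J (e t)) * (T0 (J (e v)))^st)) * T z
    = (pair h k * (a (- h) * chi w (- h)
                  * \sum_y (b k v y p w)^* * b (- h) y x z u)
      - eps / (d * sqn) * ((c u)^* * (u == w)%:R)
        * (epsL p * (bar p == x)%:R * (epsL v * (bar v == z)%:R))) *: 1.
  rewrite !mulrBr mulrBl scalerBl !(alg_scaler, alg_scalel) -mulr_suml.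
  congr (_ - _).
    rewrite !diagE conjCK !(alg_scaler, alg_scalel) scalerA.
    transitivity ((pair h k * (a (- h) * chi w (- h))) *: ((T x)^st
      * ((T p)^st * (B k (e w))^st * T v) * B (- h) (e u) * T z)).
      by rewrite !mulrA.
    rewrite (coef_star_bra e_basis D_cstar T0_isometry B_range).
    rewrite !(mulr_sumr, mulr_suml) !scaler_sumr scaler_suml.
    apply: eq_bigr => y _; rewrite !(alg_scaler, alg_scalel).
    rewrite (coef_full e T0_isometry B_range) !scalerA; congr (_ *: _).
    by ring.
  rewrite !diagE linearZl_LR /= (dot_basis e_basis) (mulrA (T p)^st).
  rewrite starT_J_vector !(alg_scaler, alg_scalel) !mulrA TsT.
  rewrite !alg_scalel mul1r TsT !scalerA epsL_real [x == _]eq_sym.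
  by congr (_ *: _); ring.
split=> [E h k u v w p x z|F].
  by apply: (@scalar_inj _ D); rewrite -lhs -rhs E.
move=> h k xi eta zeta.
move: xi; apply: (semilin_ext e_basis (b := false)) => [||u];
  [by semilin_tac|by semilin_tac|].
move: eta; apply: (semilin_ext e_basis (b := false)) => [||v];
  [by semilin_tac|by semilin_tac|].
move: zeta; apply: (semilin_ext e_basis (b := true)) => [||w];
  [by semilin_tac|by semilin_tac|].
apply: (ket_ext (e := e) (star := star) (T0 := T0)) => [||p].
- rewrite mulr_sumr; apply: eq_bigr => g _; rewrite mulr_sumr.
  by apply: eq_bigr => t _; rewrite !mulrA B_ket.
- rewrite mulrBr !alg_scaler -mulr_suml !mulrA B_star_bra.
  by rewrite -/V Q0_J_vector.
apply: (ket_ext (e := e) (star := star) (T0 := T0)) => [||x].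
- rewrite !mulr_sumr; apply: eq_bigr => g _; rewrite !mulr_sumr.
  by apply: eq_bigr => t _; rewrite !mulrA -(mulrA Q) B_ket2.
- rewrite !mulrBr !alg_scaler -mulr_suml -/V (mulrA _ V) starT_J_vector.
  rewrite !(alg_scaler, alg_scalel) (mulrA Q (T (bar p))) QT.
  (* The part of the product to the left of [B (- h) (e u)] is the adjoint of an element of the
     image of [T0], which is the situation of [B_ket2]. *)
  have := congr1 star (T0inv_sandwich e_basis T0_isometry B_range k (e v)
     (Ast (- h) (e w)) (e p)).
  rewrite !(starM D_cstar, starK D_cstar) => TB.
  by rewrite (mulrA (T p)^st) -TB B_ket2.
apply: (bra_ext (e := e) (star := star) (T0 := T0)) => [||z].
- rewrite -!mulrA; do 2!congr (_ * _); rewrite mulr_suml.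
  apply: eq_bigr => g _; rewrite mulr_suml; apply: eq_bigr => t _.
  by rewrite -!mulrA; congr (_ * _); rewrite mulrA B_star_ket2.
- rewrite -!mulrA; do 2!congr (_ * _); rewrite mulrBl !alg_scalel.
  by rewrite -mulr_suml -!mulrA B_bra TQ.
by rewrite lhs rhs F.
Qed.

End Equations.

(** * The coefficient equations *)

Section Scalars.
Variables (R : realType) (G : finZmodType) (m : nat) (eps : R[i]).
Variables (pair : G -> G -> R[i]) (L : finType) (bar : L -> L).
Variables (a : G -> R[i]) (chi : L -> G -> R[i]) (c epsL : L -> R[i]).
Variable b : G -> L -> L -> L -> L -> R[i].
Hypothesis m_gt0 : (0 < m)%N.
Hypothesis eps_sign : eps = 1 \/ eps = -1.
Hypothesis pair_bichar : symmetric_bicharacter pair.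
Hypothesis pair_nondeg : nondegenerate_pairing pair.
Hypothesis card_L : (#|L|%:R : R[i]) = m%:R / #|G|%:R.
Hypothesis barK : involutive bar.
Hypothesis a_circle : forall g, `|a g| = 1.
Hypothesis a_even : forall g, a (- g) = a g.
Hypothesis a_mul : forall g h, a g * a h = pair g h * a (g + h).
Hypothesis chi_char : forall t, character (chi t).
Hypothesis chi_bar : forall t g, chi (bar t) g = (chi t g)^-1.
Hypothesis c_circle : forall t, `|c t| = 1.
Hypothesis c_bar : forall t, c (bar t) = c t.
Hypothesis a_chi_sum : forall t, \sum_g a g * chi t g = sqrtn R G * c t ^- 3.
Hypothesis epsL_sign : forall t, epsL t = 1 \/ epsL t = -1.
Hypothesis epsL_bar : forall t, epsL t * epsL (bar t) = eps.

Local Notation d := (dconst R G m).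
Local Notation sqn := (sqrtn R G).
Local Notation n := (#|G|%:R : R[i]).

(** * Phases, characters, and the constants n and d *)

Lemma unit_neq0 (z : R[i]) : `|z| = 1 -> z != 0.
Proof. by move=> z1; rewrite -normr_eq0 z1 oner_neq0. Qed.

Lemma unit_conj (z : R[i]) : `|z| = 1 -> z^* = z^-1.
Proof.
move=> z1; apply: (mulfI (unit_neq0 z1)).
by rewrite -normCK z1 expr1n divff // unit_neq0.
Qed.

Lemma character_neq0 (psi : G -> R[i]) g : character psi -> psi g != 0.
Proof. by case=> u _; apply: unit_neq0. Qed.

Lemma character_conj (psi : G -> R[i]) g :
  character psi -> (psi g)^* = (psi g)^-1.
Proof. by case=> u _; apply: unit_conj. Qed.

Lemma character0 (psi : G -> R[i]) : character psi -> psi 0 = 1.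
Proof.
move=> cp; apply: (mulfI (character_neq0 0 cp)).
by rewrite mulr1 -(proj2 cp) addr0.
Qed.

Lemma characterN (psi : G -> R[i]) g : character psi -> psi (- g) = (psi g)^-1.
Proof.
move=> cp; apply: (mulfI (character_neq0 g cp)).
by rewrite -(proj2 cp) subrr (character0 cp) divff // character_neq0.
Qed.

Lemma character_sum0 (psi : G -> R[i]) g :
  character psi -> psi g != 1 -> \sum_h psi h = 0.
Proof.
move=> cp pg.
have : psi g * (\sum_h psi h) = \sum_h psi h.
  rewrite mulr_sumr [RHS](reindex_inj (addrI g)) /=.
  by apply: eq_bigr => h _; rewrite (proj2 cp).
move=> /eqP; rewrite -subr_eq0 -{2}[\sum_h _]mul1r -mulrBl mulf_eq0 subr_eq0.
by rewrite (negPf pg) => /eqP.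
Qed.

Lemma pair_char g : character (pair g). Proof. by case: pair_bichar. Qed.
Lemma pairC g h : pair g h = pair h g. Proof. by case: pair_bichar. Qed.
Lemma pairDr g h k : pair g (h + k) = pair g h * pair g k.
Proof. by case: (pair_char g). Qed.
Lemma pairDl g h k : pair (g + h) k = pair g k * pair h k.
Proof. by rewrite !(pairC _ k) pairDr. Qed.
Lemma pairNr g h : pair g (- h) = (pair g h)^-1.
Proof. exact: characterN (pair_char g). Qed.
Lemma pairNl g h : pair (- g) h = (pair g h)^-1.
Proof. by rewrite !(pairC _ h) pairNr. Qed.
Lemma pair0r g : pair g 0 = 1. Proof. exact: character0 (pair_char g). Qed.
Lemma pair0l g : pair 0 g = 1. Proof. by rewrite pairC pair0r. Qed.
Lemma pair_conj g h : (pair g h)^* = (pair g h)^-1.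
Proof. exact: character_conj (pair_char g). Qed.
Lemma pair_neq0 g h : pair g h != 0.
Proof. exact: character_neq0 (pair_char g). Qed.

Lemma chiD t g h : chi t (g + h) = chi t g * chi t h.
Proof. by case: (chi_char t). Qed.
Lemma chiN t g : chi t (- g) = (chi t g)^-1.
Proof. exact: characterN (chi_char t). Qed.
Lemma chi0 t : chi t 0 = 1. Proof. exact: character0 (chi_char t). Qed.
Lemma chi_conj t g : (chi t g)^* = (chi t g)^-1.
Proof. exact: character_conj (chi_char t). Qed.
Lemma chi_neq0 t g : chi t g != 0.
Proof. exact: character_neq0 (chi_char t). Qed.

Lemma a_neq0 g : a g != 0. Proof. exact: unit_neq0. Qed.
Lemma a_conj g : (a g)^* = (a g)^-1. Proof. exact: unit_conj. Qed.
Lemma a0 : a 0 = 1.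
Proof.
by apply: (mulfI (a_neq0 0)); rewrite a_mul addr0 pair0l mul1r mulr1.
Qed.
Lemma aD g h : a (g + h) = (pair g h)^-1 * a g * a h.
Proof. by rewrite -mulrA a_mul mulKf // pair_neq0. Qed.
(** [a] is a quadratic function whose bicharacter is [pair]; evenness lets [a_mul] be evaluated at
    [g] and [- g]. *)
Lemma pair_diag g : pair g g = (a g)^-2.
Proof.
have := a_mul g (- g); rewrite a_even subrr a0 mulr1 pairNr => H.
by rewrite -[LHS]invrK -H expr2.
Qed.

Lemma c_neq0 t : c t != 0. Proof. exact: unit_neq0. Qed.
Lemma c_conj t : (c t)^* = (c t)^-1. Proof. exact: unit_conj. Qed.

Lemma eps_neq0 : eps != 0.
Proof. by case: eps_sign => ->; rewrite ?oppr_eq0 oner_neq0. Qed.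
Lemma epsL_neq0 t : epsL t != 0.
Proof. by case: (epsL_sign t) => ->; rewrite ?oppr_eq0 oner_neq0. Qed.
Lemma eps_conj : eps^* = eps.
Proof. by case: eps_sign => ->; rewrite ?rmorphN rmorph1. Qed.
Lemma epsL_conj t : (epsL t)^* = epsL t.
Proof. by case: (epsL_sign t) => ->; rewrite ?rmorphN rmorph1. Qed.
Lemma eps_sq : eps * eps = 1.
Proof. by case: eps_sign => ->; rewrite ?mulrNN mulr1. Qed.
Lemma epsL_sq t : epsL t * epsL t = 1.
Proof. by case: (epsL_sign t) => ->; rewrite ?mulrNN mulr1. Qed.
Lemma epsL_barE t : epsL (bar t) = eps * epsL t.
Proof. by rewrite -(epsL_bar t) mulrAC epsL_sq mul1r. Qed.

Lemma n_neq0 : n != 0.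
Proof. by rewrite pnatr_eq0 -lt0n; apply/card_gt0P; exists 0. Qed.

Lemma sqn_sq : sqn * sqn = n.
Proof.
rewrite /sqrtn -rmorphM /= -expr2 sqr_sqrtr ?ler0n //.
by rewrite rmorph_nat.
Qed.

Lemma sqn_neq0 : sqn != 0.
Proof. by have := n_neq0; rewrite -sqn_sq mulf_eq0 orbb. Qed.

Lemma real_conj (x : R) : (x%:C%C)^* = x%:C%C.
Proof. by apply/CrealP; rewrite complex_real. Qed.

Lemma sqn_conj : sqn^* = sqn. Proof. exact: real_conj. Qed.
Lemma d_conj : d^* = d. Proof. exact: real_conj. Qed.

Lemma d_neq0 : d != 0.
Proof.
rewrite /dconst; apply/eqP => /(congr1 (@complex.Re R)) /= /eqP.
rewrite mulf_eq0 invr_eq0 pnatr_eq0 orbF gt_eqF //.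
by rewrite ltr_wpDr ?sqrtr_ge0 // ltr0n.
Qed.

(** [d] is the positive root of this quadratic equation. Apart from [d] being real and nonzero,
    nothing else about it is used. *)
Lemma d_sq : d * d = m%:R * d + n.
Proof.
rewrite /dconst; set s := Num.sqrt _.
have s2 : s * s = m%:R ^+ 2 + 4 * #|G|%:R.
  by rewrite -expr2 sqr_sqrtr // addr_ge0 ?exprn_ge0 ?mulr_ge0 ?ler0n.
rewrite -!(rmorph_nat (@real_complex R)) -!rmorphM -rmorphD /=; congr (_%:C%C).
by field: s2.
Qed.

Local Notation hb g r s t u := (fourier pair (fun h => b h r s t u) g).

(** * Fourier analysis for the pairing *)

Lemma pair_sum g : \sum_k pair k g = n * (g == 0)%:R.
Proof.
case: eqP => [->|/eqP g0].
  by rewrite (eq_bigr _ (fun k _ => pair0r k)) sumr_const mulr1.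
have [k kg] : exists k, pair g k != 1.
  apply/not_existsP => H; move/eqP: g0; apply; apply: pair_nondeg => k.
  by apply/eqP/negPn/negP/H.
rewrite mulr0 -[RHS](character_sum0 (pair_char g) kg).
by apply: eq_bigr => h _; rewrite pairC.
Qed.

Lemma pair_sum_conj g : \sum_k (pair k g)^* = n * (g == 0)%:R.
Proof.
rewrite -[LHS]conjCK rmorph_sum (eq_bigr _ (fun k _ => conjCK _)) pair_sum.
by rewrite rmorphM !rmorph_nat.
Qed.

(** A character different from every [pair p] is orthogonal to all of them, so its Fourier transform
    vanishes; but the sum of the transform over [p] is n times [psi 0], that is n. *)
Lemma character_pair (psi : G -> R[i]) :
  character psi -> exists p, forall h, psi h = pair p h.
Proof.
move=> cp; apply: contrapT => /forallNP no.
have z p : \sum_h psi h * (pair p h)^* = 0.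
  have /existsNP[h /eqP ph] := no p.
  have ch : character (fun h => psi h * (pair p h)^*).
    split=> [g|g g'].
      by rewrite normrM norm_conjC !(proj1 (pair_char _), proj1 cp) mulr1.
    by rewrite pairDr rmorphM (proj2 cp) /= mulrACA.
  apply: (character_sum0 (g := h) ch); apply: contra ph => /eqP H.
  by rewrite -[psi h]mulr1 -(divff (pair_neq0 p h)) mulrCA -pair_conj H mulr1.
have : \sum_p \sum_h psi h * (pair p h)^* = 0 by rewrite big1.
rewrite exchange_big (bigD1 0) //= [X in _ + X]big1 => [|h h0].
  rewrite addr0 -mulr_sumr pair_sum_conj eqxx mulr1 (character0 cp) mul1r.
  exact/eqP/n_neq0.
by rewrite -mulr_sumr pair_sum_conj (negPf h0) !mulr0.
Qed.

(** Modulation by [pair q] becomes a shift of the frequency, translation by [g] becomes a phase.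
    Both are needed at once in the derivation of (E8). *)
Lemma parseval (f f' : G -> R[i]) q g :
  \sum_h pair q h * f h * (f' (h - g))^*
  = \sum_k pair (k + q) g * fourier pair f k * (fourier pair f' (k + q))^*.
Proof.
transitivity (\sum_k \sum_h \sum_h' n^-1 * (f h * (f' h')^*
   * (pair (k + q) (g + h') * (pair k h)^*))); last first.
  apply: eq_bigr => k _.
  rewrite !fourierE rmorphM fmorphV rmorph_sum /= sqn_conj.
  rewrite [X in _ = _ * X * _]mulr_sumr [X in _ = X * _]mulr_sumr mulr_suml.
  apply: eq_bigr => h _; rewrite !mulr_sumr; apply: eq_bigr => h' _.
  rewrite !rmorphM /= conjCK -sqn_sq pairDr.
  by field; rewrite sqn_neq0.
rewrite exchange_big; apply: eq_bigr => h _; rewrite exchange_big /=.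
(* The sum over frequencies is a character sum that vanishes unless [h' = h - g]. *)
rewrite (bigD1 (h - g)) //= [X in _ = _ + X]big1 => [|h' h'g].
  rewrite addr0 -!mulr_sumr [g + _]addrC subrK.
  rewrite (eq_bigr (fun=> pair q h)) => [|k _].
    by rewrite sumr_const -[X in _ * (_ * X)]mulr_natl; field; rewrite n_neq0.
  by rewrite pairDl pair_conj mulrAC divff ?mul1r // pair_neq0.
rewrite -!mulr_sumr (eq_bigr (fun k => pair q (g + h') * pair k (g + h' - h))).
  rewrite -mulr_sumr pair_sum (_ : (_ == 0) = false) ?mulr0 //.
  by apply: contraNF h'g; rewrite subr_eq0 => /eqP <-; rewrite addrC addKr.
by move=> k _; rewrite pairDl [pair k (_ - _)]pairDr pairNr pair_conj; ring.
Qed.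

(** * Coefficient equations against p1-p10 *)

Lemma conjM (x y : R[i]) : (x * y)^* = x^* * y^*. Proof. exact: rmorphM. Qed.
Lemma conjV (x : R[i]) : (x^-1)^* = (x^*)^-1. Proof. exact: fmorphV. Qed.

Definition conjE := (conjM, conjV, chi_conj, eps_conj, epsL_conj, c_conj,
  a_conj, pair_conj, sqn_conj, d_conj, @conjCK R[i], @invrK R[i]).

Let bar_eq s t : (bar s == t) = (s == bar t) := inv_eq barK s t.

Lemma sum_bar (f : L -> R[i]) : \sum_r f (bar r) = \sum_r f r.
Proof. by rewrite [RHS](reindex_inj (inv_inj barK)). Qed.

Lemma sum_deltal (I : finType) (f : I -> R[i]) j :
  \sum_i (i == j)%:R * f i = f j.
Proof.
rewrite (bigD1 j) //= big1 => [|i /negPf ij]; first by rewrite eqxx mul1r addr0.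
by rewrite ij mul0r.
Qed.

(** Common form of (E5) and p1: [fourier] has a conjugated kernel, so p1 is this identity at [- g].
    Up to phases, the transform permutes the three legs [r], [s], [bar t] cyclically and leaves [u]
    in place. *)
Definition rotation : Prop := forall g r s t u,
  hb g r s t u = eps * epsL r * epsL t * c u * a g * (chi u g)^-1
                 * b (- g) s (bar t) (bar r) u.

Lemma p1_rotation : p1 eps pair bar a chi c epsL b <-> rotation.
Proof.
have H g r s t u :
    hb (- g) r s t u = sqn^-1 * \sum_(h : G) pair g h * b h r s t u.
  rewrite fourierE; congr (_ * _); apply: eq_bigr => h _.
  by rewrite pairNl !conjE.
split=> P g r s t u.
  by rewrite -[g in LHS]opprK H P a_even chiN.
by rewrite -H P opprK a_even chiN invrK.
Qed.

Lemma rotation_dual :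
  (forall g r s t u, hb g r s t u
    = eps * (a (- g) * chi u (- g) * c u * epsL (bar r) * epsL (bar t)
             * b (- g) s (bar t) (bar r) u)) <-> rotation.
Proof.
suff H g r s t u : eps * (a (- g) * chi u (- g) * c u * epsL (bar r)
      * epsL (bar t) * b (- g) s (bar t) (bar r) u)
    = eps * epsL r * epsL t * c u * a g * (chi u g)^-1
      * b (- g) s (bar t) (bar r) u.
  by split=> P g r s t u; rewrite P H.
by rewrite a_even chiN !epsL_barE; ring: eps_sq.
Qed.

(** A rotation turns the upper pair [s], [bar s] of (E1) into one index repeated above and below, so
    the sum becomes the partial trace in p2. *)
Lemma p2_dual : rotation ->
  (forall t u, \sum_s epsL s * hb 0 s (bar s) t u
              = - (d^-1 * (epsL u * c u * (bar u == t)%:R)))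
  <-> p2 m b.
Proof.
move=> rot.
have S t u : \sum_s epsL s * hb 0 s (bar s) t u
    = eps * epsL t * c u * \sum_s b 0 s (bar t) s u.
  rewrite -sum_bar mulr_sumr; apply: eq_bigr => s _.
  rewrite rot ?barK a0 chi0 oppr0 invr1.
  by ring: (epsL_sq s).
have RR t u : - (d^-1 * (epsL u * c u * (bar u == t)%:R))
    = eps * epsL t * c u * - ((bar t == u)%:R / d).
  rewrite !bar_eq [u == _]eq_sym bar_eq.
  case: eqP => [->|_]; last by rewrite !(mul0r, mulr0, oppr0).
  by rewrite epsL_barE; ring: eps_sq.
split=> P t u.
  have := P (bar t) u; rewrite S RR barK; apply: mulfI.
  by rewrite !mulf_neq0 ?eps_neq0 ?epsL_neq0 ?c_neq0.
by rewrite S RR P.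
Qed.

Lemma p4_dual : rotation ->
  (forall h t t' u u', \sum_r \sum_s (hb h r s t' u')^* * hb h r s t u
    = (u == u')%:R / n * (t' == t)%:R
      - (h == 0)%:R / d * ((epsL u' * (c u')^* * (bar u' == t')%:R)
                           * (epsL u * c u * (bar u == t)%:R)))
  <-> p4 m b.
Proof.
move=> rot.
(* The phase left by the two rotated factors. It is 1 on the support of the 1/n term, and on the
   support of the 1/d term it equals the phase that (E2) carries there. *)
pose K h t t' u u' :=
  epsL t' * epsL t * (c u')^-1 * c u * chi u' h * (chi u h)^-1.
have K_neq0 h t t' u u' : K h t t' u u' != 0.
  by rewrite !mulf_neq0 ?invr_eq0 ?epsL_neq0 ?c_neq0 ?chi_neq0.
have S h t t' u u' : \sum_r \sum_s (hb h r s t' u')^* * hb h r s t u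
    = K h t t' u u' * \sum_r \sum_s
      (b (- h) r (bar t') s u')^* * b (- h) r (bar t) s u.
  rewrite exchange_big mulr_sumr; apply: eq_bigr => s _.
  rewrite -sum_bar mulr_sumr; apply: eq_bigr => r _.
  rewrite !rot ?barK !conjE /K ?epsL_barE.
  field: eps_sq (epsL_sq r); by rewrite ?a_neq0 ?c_neq0 ?chi_neq0.
have RR h t t' u u' : (u == u')%:R / n * (t' == t)%:R
      - (h == 0)%:R / d * ((epsL u' * (c u')^* * (bar u' == t')%:R)
                           * (epsL u * c u * (bar u == t)%:R))
    = K h t t' u u' * ((bar t == bar t')%:R * (u == u')%:R / n
        - (- h == 0)%:R * (bar t == u)%:R * (bar t' == u')%:R / d).
  rewrite (inj_eq (inv_inj barK)) oppr_eq0 mulrBr ![bar t == _]eq_sym.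
  rewrite ![bar t' == _]eq_sym -!bar_eq [t' == t]eq_sym /K; congr (_ - _).
    case: eqP => [->|_]; last by rewrite !(mul0r, mulr0).
    case: eqP => [->|_]; last by rewrite !(mul0r, mulr0).
    field: (epsL_sq t').
    by rewrite ?n_neq0 ?c_neq0 ?chi_neq0.
  case: eqP => [->|_]; last by rewrite !(mul0r, mulr0).
  case: (bar u' =P t') => [<-|_]; last by rewrite !(mul0r, mulr0).
  case: (bar u =P t) => [<-|_]; last by rewrite !(mul0r, mulr0).
  rewrite !chi0 !epsL_barE c_conj; move: (d) d_neq0 => d' d'0.
  by field: eps_sq; rewrite d'0 c_neq0.
split=> P.
  move=> g s s' u u'; have := P (- g) (bar s) (bar s') u u'.
  by rewrite S RR !barK !opprK; apply: mulfI; apply: K_neq0.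
by move=> h t t' u u'; rewrite S RR P.
Qed.

(** The summed index [t] of (E6) rotates into the second upper place, where p5 sums. The phases in
    [a], [c] and [chi] cancel because both factors share [g] and [u]. *)
Lemma p5_dual : rotation ->
  (forall g r s r' s', \sum_u \sum_t hb g r s t u * (hb g r' s' t u)^*
    = n^-1 * ((r == r')%:R * (s == s')%:R)
      - (g == 0)%:R / d * ((epsL r * (bar r == s)%:R)
                           * (epsL r' * (bar r' == s')%:R)))
  <-> p5 m b.
Proof.
move=> rot.
have S g r s r' s' : \sum_u \sum_t hb g r s t u * (hb g r' s' t u)^*
    = epsL r * epsL r' * \sum_t \sum_u
      b (- g) s t (bar r) u * (b (- g) s' t (bar r') u)^*.
  rewrite exchange_big -sum_bar mulr_sumr; apply: eq_bigr => t _.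
  rewrite mulr_sumr; apply: eq_bigr => u _.
  rewrite !rot ?barK !conjE ?epsL_barE.
  field: eps_sq (epsL_sq t); by rewrite ?a_neq0 ?c_neq0 ?chi_neq0.
have RR g r s r' s' : n^-1 * ((r == r')%:R * (s == s')%:R)
      - (g == 0)%:R / d * ((epsL r * (bar r == s)%:R)
                           * (epsL r' * (bar r' == s')%:R))
    = epsL r * epsL r' * ((s == s')%:R * (bar r == bar r')%:R / n
      - (- g == 0)%:R * (s == bar r)%:R * (s' == bar r')%:R / d).
  rewrite (inj_eq (inv_inj barK)) oppr_eq0 mulrBr ![_ == bar _]eq_sym.
  congr (_ - _); last by ring.
  case: eqP => [->|_]; last by rewrite !(mul0r, mulr0).
  by ring: (epsL_sq r').
split=> P.
  move=> g r r' t t'; have := P (- g) (bar t) r (bar t') r'.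
  rewrite S RR !barK !opprK; apply: mulfI.
  by rewrite mulf_neq0 ?epsL_neq0.
by move=> g r s r' s'; rewrite S RR P.
Qed.

Lemma p3_of_p2_p5 : p2 m b -> p5 m b -> p3 m b.
Proof.
move=> P2 P5 r t.
(* With M and v as in the overview, this computes M M^* v from p5, where v^* v is the number of
   indices. *)
have : \sum_s \sum_u b 0 r s t u * \sum_r' (b 0 r' s r' u)^*
     = (r == t)%:R * (n^-1 - #|L|%:R / d).
  transitivity (\sum_r' \sum_s \sum_u b 0 r s t u * (b 0 r' s r' u)^*).
    rewrite [RHS]exchange_big; apply: eq_bigr => s _; rewrite [RHS]exchange_big.
    by apply: eq_bigr => u _; rewrite mulr_sumr.
  rewrite (eq_bigr _ (fun r' _ => P5 0 r r' t r')) sumrB mulrBr; congr (_ - _).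
    rewrite (bigD1 r) //= big1 => [|r' /negPf r'r].
      by rewrite eqxx mul1r addr0 [t == r]eq_sym.
    by rewrite eq_sym r'r !mul0r.
  rewrite (eq_bigr (fun=> (r == t)%:R / d)) => [|r' _].
    by rewrite sumr_const -[LHS]mulr_natr mulrAC mulrA.
  by rewrite !eqxx mul1r mulr1.
(* By p2, M^* v = - v / d, so the quantity just computed is also - M v / d. *)
have P2' s u : \sum_r' (b 0 r' s r' u)^* = - ((s == u)%:R / d).
  rewrite -rmorph_sum P2 rmorphN rmorphM fmorphV rmorph_nat /=.
  by rewrite d_conj.
rewrite (eq_bigr (fun s => - d^-1 * b 0 r s t s)) => [|s _].
  rewrite -mulr_sumr card_L => H.
  have -> : \sum_s b 0 r s t s = - d * (- d^-1 * \sum_s b 0 r s t s).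
    by rewrite !mulNr mulrN opprK mulrA divff ?d_neq0 ?mul1r.
  rewrite H; have := d_sq => dd.
  (* This is d^2 - m d = n divided by n d^2. *)
  suff -> : n^-1 - m%:R / n / d = (d * d)^-1.
    by move: (d) d_neq0 => d' d'0; field; rewrite d'0.
  have -> : n^-1 - m%:R / n / d = (d - m%:R) / (n * d).
    by move: (d) d_neq0 => d' d'0; field; rewrite d'0 n_neq0.
  have -> : d - m%:R = n / d.
    apply: (mulIf d_neq0); rewrite mulrBl dd divfK ?d_neq0 //.
    by rewrite addrAC subrr add0r.
  by move: (d) d_neq0 => d' d'0; field; rewrite d'0 n_neq0.
rewrite (bigD1 s) //= [X in _ + X = _]big1 => [|u /negPf us].
  by rewrite addr0 P2' eqxx mul1r mulNr mulrN mulrC.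
by rewrite P2' eq_sym us mul0r oppr0 mulr0.
Qed.

(** Turns the support condition p6 into a rewriting rule: next to a coefficient, the two products of
    characters are interchangeable, the coefficient being 0 when they differ. *)
Lemma p6_select h g r s t u : p6 chi b ->
  chi r h * chi s h * b g r s t u = chi t h * chi u h * b g r s t u.
Proof.
move=> P; have [E|NE] := pselect (chi r \* chi s = chi t \* chi u).
  by have := congr1 (fun f => f h) E => /= ->.
by rewrite (P _ _ _ _ NE) !mulr0.
Qed.

Lemma p6_selectV h g r s t u : p6 chi b ->
  (chi r h * chi s h)^-1 * b g r s t u = (chi t h * chi u h)^-1 * b g r s t u.
Proof.
move=> P; have [E|NE] := pselect (chi r \* chi s = chi t \* chi u).
  by have := congr1 (fun f => f h) E => /= ->.
by rewrite (P _ _ _ _ NE) !mulr0.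
Qed.

Lemma p6_dual :
  (forall g h r s t u, a h * chi u h * b g r s t u
    = a h * chi r h * (a h * chi s h) * (a h * chi t h)^* * b g r s t u)
  <-> p6 chi b.
Proof.
split=> [P r s t u neq g|P g h r s t u].
  apply/eqP/negPn/negP => b0; apply: neq; apply/funext => h /=.
  have := P g h r s t u; move/(mulIf b0); rewrite !conjE => E.
  apply: (mulfI (a_neq0 h)); rewrite [RHS]mulrCA E.
  by field; rewrite a_neq0 chi_neq0.
transitivity (a h * (chi t h)^-1 * (chi t h * chi u h * b g r s t u)).
  by field; rewrite chi_neq0.
rewrite -p6_select // !conjE.
by field; rewrite a_neq0 chi_neq0.
Qed.

Lemma p7_dual :
  (forall g r s t u, (b g r s t u)^*
    = eps * (epsL u * (a (- g) * chi (bar u) (- g)) * epsL (bar s)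
             * b (- g) t (bar s) r (bar u)))
  <-> p7 bar a chi epsL b.
Proof.
suff H g r s t u : eps * (epsL u * (a (- g) * chi (bar u) (- g)) * epsL (bar s)
             * b (- g) t (bar s) r (bar u))
    = epsL s * epsL u * a g * chi u g * b (- g) t (bar s) r (bar u).
  by split=> P g r s t u; rewrite P H.
by rewrite a_even chi_bar chiN invrK epsL_barE; ring: eps_sq.
Qed.

(** p7 and p8 each conjugate and negate [g], so their composite is a linear symmetry at the same
    [g]; p6 then trades the characters of [t], [u] in its phase for those of [r], [s]. *)
Lemma p9_of_p6_p7_p8 : p6 chi b -> p7 bar a chi epsL b ->
  p8 bar a chi c epsL b -> p9 bar chi c epsL b.
Proof.
move=> P6 P7 P8 g r s t u.
rewrite -[LHS]conjCK P7 !conjE P8 opprK chiN a_even.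
have := p6_select g g (bar t) (bar u) (bar r) (bar s) P6; rewrite !chi_bar.
set w := b g _ _ _ _ => sel; rewrite c_conj.
transitivity (epsL r * epsL s * epsL t * epsL u * c t * (c r)^-1
  * ((chi t g)^-1 * (chi u g)^-1 * w)).
  by field; rewrite a_neq0 ?c_neq0 ?chi_neq0.
by rewrite sel; field; rewrite ?c_neq0 ?chi_neq0.
Qed.

(** The right-hand side of p8, grouped as it occurs in (E7), so that (E7) becomes the inner product
    of [b] with the conjugate of this family. *)
Let twin h s y t x := epsL s * c s * (a (- h) * chi (bar s) (- h)) * epsL t
                      * (c t)^* * b (- h) (bar s) x (bar t) y.

Lemma p8_twin : p8 bar a chi c epsL b <->
  forall h s y t x, (b h s y t x)^* = twin h s y t x.
Proof.
suff H h s y t x : twin h s y t x = epsL t * epsL s * c s * (c t)^* * a h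
    * chi s h * b (- h) (bar s) x (bar t) y.
  by split=> P h s y t x; rewrite P H.
by rewrite /twin a_even chi_bar chiN invrK; ring.
Qed.

(** Explains the constant in (E7): in p4 taken at equal second indices and summed, the 1/n term adds
    up to the number m/n of indices, and only [h = 0], [y = u] contributes to the 1/d term. *)
Lemma p4_sum x u : p4 m b ->
  \sum_h \sum_s \sum_t \sum_y b h s y t u * (b h s y t x)^*
  = (m%:R / n - d^-1) * (x == u)%:R.
Proof.
move=> P4.
transitivity (\sum_(h : G) \sum_(y : L) ((u == x)%:R / n
                - (h == 0)%:R * (y == u)%:R * (y == x)%:R / d)).
  apply: eq_bigr => h _.
  transitivity (\sum_s \sum_y \sum_t b h s y t u * (b h s y t x)^*).
    by apply: eq_bigr => s _; rewrite exchange_big.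
  rewrite exchange_big; apply: eq_bigr => y _.
  have := P4 h y y u x; rewrite eqxx mul1r => <-.
  by apply: eq_bigr => s _; apply: eq_bigr => t _; rewrite mulrC.
transitivity (\sum_(h : G) ((u == x)%:R / n *+ #|L|
                - (h == 0)%:R * ((u == x)%:R / d))).
  apply: eq_bigr => h _; rewrite sumrB sumr_const; congr (_ - _).
  rewrite -[RHS]mulr1.
  rewrite -(sum_deltal (fun y => (h == 0)%:R * ((y == x)%:R / d)) u).
  by rewrite mulr1; apply: eq_bigr => y _; rewrite mulrCA !mulrA.
rewrite sumrB sumr_const (sum_deltal (fun=> (u == x)%:R / d)).
rewrite -[_ *+ #|L|]mulr_natr card_L -[_ *+ _]mulr_natr [x == u]eq_sym.
by move: (d) d_neq0 => d' d'0; field; rewrite d'0 n_neq0.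
Qed.

(** [twin] is [b] up to a phase of modulus one and a permutation of the index set: negate [h], apply
    [bar] to [s] and [t], swap [y] with [u]. *)
Lemma twin_norm :
  \sum_h \sum_s \sum_t \sum_y \sum_u twin h s y t u * (twin h s y t u)^*
  = \sum_h \sum_s \sum_t \sum_y \sum_u b h s y t u * (b h s y t u)^*.
Proof.
rewrite [RHS](reindex_inj oppr_inj) /=; apply: eq_bigr => h _.
rewrite -[RHS]sum_bar; apply: eq_bigr => s _.
rewrite -[RHS]sum_bar; apply: eq_bigr => t _.
rewrite [RHS]exchange_big; apply: eq_bigr => y _; apply: eq_bigr => u _.
rewrite /twin !conjE.
field: (epsL_sq s) (epsL_sq t); by rewrite ?a_neq0 ?c_neq0 ?chi_neq0.
Qed.

(* Equality case of Cauchy-Schwarz: the families [b] and [twin^*] have the same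
   norm, and E7 says that their inner product is the square of that norm. *)
Lemma p8_of_p4_E7 : p4 m b ->
  (forall x u, (m%:R / n - d^-1) * (x == u)%:R
    = \sum_h \sum_s \sum_t \sum_y b h s y t u * twin h s y t x) ->
  p8 bar a chi c epsL b.
Proof.
move=> P4 P7.
pose N := \sum_h \sum_s \sum_t \sum_y \sum_u b h s y t u * (b h s y t u)^*.
have swap (f : G -> L -> L -> L -> L -> R[i]) :
    \sum_h \sum_s \sum_t \sum_y \sum_u f h s t y u
    = \sum_u \sum_h \sum_s \sum_t \sum_y f h s t y u.
  rewrite [RHS]exchange_big; apply: eq_bigr => h _.
  rewrite [RHS]exchange_big; apply: eq_bigr => s _.
  rewrite [RHS]exchange_big; apply: eq_bigr => t _.
  by rewrite [RHS]exchange_big.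
have N1 : \sum_h \sum_s \sum_t \sum_y \sum_u b h s y t u * twin h s y t u = N.
  rewrite /N !swap; apply: eq_bigr => u _.
  by rewrite -P7 p4_sum.
have NC : N^* = N.
  rewrite /N; do 5!(rewrite rmorph_sum; apply: eq_bigr => ? _).
  by rewrite /= conjM conjCK mulrC.
(* The squared distance expands into the two squared norms and the two conjugate inner products, all
   four equal to [N]. Its terms being nonnegative, each of them vanishes. *)
have Z : \sum_h \sum_s \sum_t \sum_y \sum_u ((b h s y t u)^* - twin h s y t u)
            * ((b h s y t u)^* - twin h s y t u)^* = 0.
  transitivity (N
    - \sum_h \sum_s \sum_t \sum_y \sum_u b h s y t u * twin h s y t u
    - ((\sum_h \sum_s \sum_t \sum_y \sum_u b h s y t u * twin h s y t u)^*
       - \sum_h \sum_s \sum_t \sum_y \sum_u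
           twin h s y t u * (twin h s y t u)^*)); last first.
    by rewrite N1 twin_norm -/N NC !subrr.
  rewrite /N; do 5!(rewrite rmorph_sum -!sumrB; apply: eq_bigr => ? _).
  move: (b _ _ _ _ _) (twin _ _ _ _ _) => x y.
  by rewrite /= conjM rmorphB /= conjCK; ring.
apply/p8_twin => h s y t u.
apply/eqP; rewrite -subr_eq0 -mul_conjC_eq0; apply/eqP.
have ge0 (z : R[i]) : 0 <= z * z^* by exact: mul_conjC_ge0.
have := psumr_eq0P _ Z; rewrite /=.
move/(_ (fun h _ => sumr_ge0 _ (fun s _ => sumr_ge0 _ (fun t _ => sumr_ge0 _
  (fun y _ => sumr_ge0 _ (fun u _ => ge0 _)))))) => /(_ h isT).
move/psumr_eq0P => /(_ (fun s _ => sumr_ge0 _ (fun t _ => sumr_ge0 _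
  (fun y _ => sumr_ge0 _ (fun u _ => ge0 _))))) => /(_ s isT).
move/psumr_eq0P => /(_ (fun t _ => sumr_ge0 _
  (fun y _ => sumr_ge0 _ (fun u _ => ge0 _)))) => /(_ t isT).
move/psumr_eq0P => /(_ (fun y _ => sumr_ge0 _ (fun u _ => ge0 _))) =>
  /(_ y isT).
by move/psumr_eq0P => /(_ (fun u _ => ge0 _)) => /(_ u isT).
Qed.

Lemma p8_dual : p4 m b ->
  (forall x u, (m%:R / n - d^-1) * (x == u)%:R
    = \sum_h \sum_s \sum_t \sum_y
        (epsL s * c s * (a (- h) * chi (bar s) (- h)) * epsL t * (c t)^*)
        * (b h s y t u * b (- h) (bar s) x (bar t) y))
  <-> p8 bar a chi c epsL b.
Proof.
move=> P4.
have S x u : \sum_h \sum_s \sum_t \sum_y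
        (epsL s * c s * (a (- h) * chi (bar s) (- h)) * epsL t * (c t)^*)
        * (b h s y t u * b (- h) (bar s) x (bar t) y)
    = \sum_h \sum_s \sum_t \sum_y b h s y t u * twin h s y t x.
  apply: eq_bigr => h _; apply: eq_bigr => s _; apply: eq_bigr => t _.
  by apply: eq_bigr => y _; rewrite mulrCA.
split=> [E|/p8_twin P x u].
  by apply: p8_of_p4_E7 => // x u; rewrite -S.
rewrite S -(p4_sum x u P4); apply: eq_bigr => h _; apply: eq_bigr => s _.
by apply: eq_bigr => t _; apply: eq_bigr => y _; rewrite P.
Qed.

(** The two sides correspond under complex conjugation. On the left p8 returns the argument
    [- g - h] to [g + h], on the right p7 returns [- h] to [h]. *)
Lemma p10_dual : p7 bar a chi epsL b -> p8 bar a chi c epsL b ->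
  (forall h k u v w p x z,
    \sum_g \sum_t \sum_y \sum_q
      (a (- g - h) * chi w (- g - h))
      * (b (- g - h) w y t u * b g p x q y * (b (g + k) v z q t)^*)
    = pair h k * (a (- h) * chi w (- h)
                  * \sum_y (b k v y p w)^* * b (- h) y x z u)
      - eps / (d * sqn) * ((c u)^* * (u == w)%:R)
        * (epsL p * (bar p == x)%:R * (epsL v * (bar v == z)%:R)))
  <-> p10 m pair bar chi c epsL b.
Proof.
move=> P7 P8.
have lhs h k u v w p x z : (\sum_g \sum_t \sum_y \sum_q
      (a (- g - h) * chi w (- g - h))
      * (b (- g - h) w y t u * b g p x q y * (b (g + k) v z q t)^*))^*
    = c w * epsL w * \sum_g \sum_q \sum_s \sum_t
      epsL t * (c t)^* * (b g p x q s)^* * b (g + h) (bar w) u (bar t) s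
      * b (g + k) v z q t.
  rewrite rmorph_sum mulr_sumr; apply: eq_bigr => g _.
  transitivity (\sum_q \sum_s \sum_t ((a (- g - h) * chi w (- g - h))
      * (b (- g - h) w s t u * b g p x q s * (b (g + k) v z q t)^*))^*).
    rewrite exchange_big rmorph_sum [RHS]exchange_big; apply: eq_bigr => y _.
    rewrite rmorph_sum [RHS]exchange_big; apply: eq_bigr => t _ /=.
    by rewrite rmorph_sum.
  rewrite mulr_sumr; apply: eq_bigr => q _; rewrite mulr_sumr.
  apply: eq_bigr => s _; rewrite mulr_sumr; apply: eq_bigr => t _.
  rewrite !conjM conjCK P8 -opprD opprK !conjE.
  by field; rewrite ?a_neq0 ?chi_neq0 ?c_neq0.
have rhs h k u v w p x z :
    (pair h k * (a (- h) * chi w (- h)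
                  * \sum_y (b k v y p w)^* * b (- h) y x z u)
      - eps / (d * sqn) * ((c u)^* * (u == w)%:R)
        * (epsL p * (bar p == x)%:R * (epsL v * (bar v == z)%:R)))^*
    = epsL u * epsL x * chi w h * (chi u h * pair h k)^*
      * (\sum_y b k v y p w * b h z (bar x) y (bar u))
      - c u * epsL (bar v) * epsL p / (d * sqn)
      * (w == u)%:R * (x == bar p)%:R * (z == bar v)%:R.
  rewrite rmorphB /=; congr (_ - _).
    rewrite !conjM rmorph_sum !mulr_sumr; apply: eq_bigr => y _.
    rewrite /= conjM conjCK P7 opprK !conjE a_even !chiN.
    by field; rewrite ?a_neq0 ?chi_neq0 ?pair_neq0.
  rewrite !conjE !rmorph_nat epsL_barE.
  rewrite [x == _]eq_sym [z == _]eq_sym [w == u]eq_sym.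
  by ring.
split=> P.
  move=> h k r u v w p x.
  by have := congr1 conjC (P h k u p r v w x); rewrite lhs rhs.
move=> h k u v w p x z; apply: (can_inj (@conjCK _)).
by rewrite lhs rhs P.
Qed.

(** After p8 removes the conjugation and [h] is replaced by [k - h], the quadratic function [a]
    contributes just the factor that makes the sum the left-hand side of p1 at [g - k]. The
    characters at [k] that remain are matched by p6. *)
Lemma E9_coef_of_p : rotation -> p1 eps pair bar a chi c epsL b -> p6 chi b ->
  p8 bar a chi c epsL b ->
  forall g k u v w y,
    eps * (a (- k) * chi w (- k) * (c y)^* * (a k * chi y k)^*
           * b (g - k) w y v u)
    = sqn^-1 * \sum_h (pair g h)^* * ((a h * chi v h)^* * (c v)^*
        * (a g * chi u g)^* * (c u)^* * (b (h - k) v u y w)^*).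
Proof.
move=> rot P1 P6 P8 g k u v w y.
have := P1 (g - k) (bar v) w (bar y) u; rewrite !barK.
set S := \sum_h _; set w' := b (g - k) w y v u => E.
have -> : \sum_h (pair g h)^* * ((a h * chi v h)^* * (c v)^*
        * (a g * chi u g)^* * (c u)^* * (b (h - k) v u y w)^*)
    = (pair g k)^-1 * (a k)^-1 * (chi v k)^-1 * (a g * chi u g)^-1 * (c u)^-1
      * epsL y * epsL v * (c y)^-1 * S.
  rewrite (reindex_inj (@subrI _ k)) mulr_sumr; apply: eq_bigr => h _ /=.
  rewrite addrAC subrr add0r P8 opprK pairDr pairNr pairDl pairNl aD pairNr.
  rewrite chiD chiN a_even [pair k h]pairC !conjE.
  by field; rewrite ?a_neq0 ?chi_neq0 ?pair_neq0 ?c_neq0.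
have sel : (chi w k * chi y k)^-1 * w' = (chi v k * chi u k)^-1 * w'.
  exact: p6_selectV.
transitivity (eps * (c y)^-1 * ((chi w k * chi y k)^-1 * w')).
  rewrite a_even chiN !conjE.
  by field; rewrite ?a_neq0 ?chi_neq0 ?c_neq0.
rewrite sel [RHS]mulrCA E !epsL_barE aD chiD a_even chiN pairNr invrK.
field: eps_sq (epsL_sq y) (epsL_sq v).
by rewrite ?a_neq0 ?chi_neq0 ?pair_neq0 ?c_neq0.
Qed.

(* Shift by [p] in the Gauss sum [a_chi_sum] of [chi u]. *)
Lemma gauss_shift u x p :
  (forall h, chi u h * (chi x h)^-1 = pair p h) ->
  c u ^+ 3 * (c x ^+ 3)^-1 * chi x p * (a p)^-1 = 1.
Proof.
move=> Hp.
have E : \sum_g a g * chi u g = (a p)^-1 * chi x p * \sum_g a g * chi x g.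
  rewrite (reindex_inj (addIr p)) mulr_sumr; apply: eq_bigr => g _ /=.
  have -> : chi u (g + p) = pair p (g + p) * chi x (g + p).
    by rewrite -Hp divfK // chi_neq0.
  (* The mixed factor [pair p g] cancels against the one from [aD]; the diagonal factor [pair p p]
     turns [a p] into its inverse. *)
  rewrite aD pairDr pair_diag chiD [pair g p]pairC.
  by field; rewrite a_neq0 pair_neq0.
move: E; rewrite !a_chi_sum mulrCA => /(mulfI sqn_neq0) E.
have -> : c u ^+ 3 * (c x ^+ 3)^-1 * chi x p * (a p)^-1
    = c u ^+ 3 * ((a p)^-1 * chi x p * (c x ^+ 3)^-1) by ring.
by rewrite -E divff // expf_neq0 ?c_neq0.
Qed.

(* Parseval is applied twice, each time turning [b] by [rotation]; this moves
   the two summation indices to the places where p4 evaluates the sum. *)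
Lemma E8_coef_of_p : rotation -> p4 m b -> p6 chi b -> p8 bar a chi c epsL b ->
  forall g u v w x,
    (g == 0)%:R * (v == w)%:R * (x == u)%:R - d^-1 * (u == w)%:R * (x == v)%:R
    = \sum_h \sum_s \sum_y
        (a h * chi w h * c w * (c y)^* * epsL y * epsL v)
        * (b h w s y u * b (g - h) (bar v) x (bar y) s).
Proof.
move=> rot P4 P6 P8 g u v w x.
(* The two families to be compared carry different characters; [p] measures the discrepancy and is 0
   when [u = x]. *)
have [p Hp] : exists p, forall h, chi u h * (chi x h)^-1 = pair p h.
  apply: character_pair; split=> [h|h k].
    by rewrite normrM normfV !(proj1 (chi_char _)) invr1 mulr1.
  by rewrite !chiD invfM mulrACA.
(* Part [p] of the modulation comes from the characters, part [- g] from expanding [a (h - g)]. [K1]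
   collects the phases of p8, [K2] and [K3] those of the two rotations. *)
pose q := p - g.
pose K1 := c w * (c v)^-1 * (a g)^-1 * chi v g.
pose K2 := epsL w * epsL v * c u * (c x)^-1 * (a q)^-1 * chi x q * pair q g.
pose K3 := epsL (bar w) * epsL (bar v) * c u * (c x)^-1.
have S1 : \sum_h \sum_s \sum_y
        (a h * chi w h * c w * (c y)^* * epsL y * epsL v)
        * (b h w s y u * b (g - h) (bar v) x (bar y) s)
    = K1 * \sum_s \sum_y \sum_h
        pair q h * b h w s y u * (b (h - g) v s y x)^*.
  rewrite exchange_big mulr_sumr; apply: eq_bigr => s _.
  rewrite exchange_big mulr_sumr; apply: eq_bigr => y _.
  rewrite mulr_sumr; apply: eq_bigr => h _.
  rewrite P8 opprB.
  have := p6_select h h w s y u P6.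
  have := p6_select h (g - h) (bar v) x (bar y) s P6; rewrite !chi_bar.
  set B := b (g - h) _ _ _ _; set B' := b h _ _ _ _ => sel sel'.
  (* Multiplying the support conditions of the two coefficients eliminates the summed indices [s]
     and [y]. *)
  have key : chi w h * (chi v h)^-1 * (B' * B) = pair p h * (B' * B).
    transitivity ((chi s h)^-1 * (chi x h)^-1 * (chi w h * chi s h * B')
                  * ((chi v h)^-1 * chi x h * B)).
      by field; rewrite ?chi_neq0.
    by rewrite sel sel' -Hp; field; rewrite ?chi_neq0.
  transitivity (a h * chi v h * c w * (c y)^-1 * epsL y * epsL v
                * (chi w h * (chi v h)^-1 * (B' * B))).
    by rewrite c_conj; field; rewrite chi_neq0 c_neq0.
  rewrite key /K1 /q aD chiD a_even chiN pairDl pairNl pairNr [pair h g]pairC.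
  by rewrite c_conj; field; rewrite ?a_neq0 ?pair_neq0 ?chi_neq0 ?c_neq0.
have S2 s y : \sum_h pair q h * b h w s y u * (b (h - g) v s y x)^*
    = K2 * \sum_k b k s (bar y) (bar w) u * (b (k - q) s (bar y) (bar v) x)^*.
  rewrite (parseval (fun h => b h w s y u) (fun h => b h v s y x)).
  rewrite (reindex_inj oppr_inj) mulr_sumr; apply: eq_bigr => k _ /=.
  rewrite !rot opprK opprD opprK aD !conjE chiD !chiN a_even pairDl !pairNl.
  have -> : chi u k = pair p k * chi x k by rewrite -Hp divfK // chi_neq0.
  have -> : pair p k = pair q k * pair k g.
    by rewrite [pair k g]pairC -pairDl subrK.
  rewrite [pair k q]pairC /K2.
  field: eps_sq (epsL_sq y).
  by rewrite ?a_neq0 ?pair_neq0 ?chi_neq0 ?c_neq0.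
(* Now there is no modulation, so the translation by [q] becomes a mere phase: both factors end at
   the same argument [- k], with the summed indices where p4 contracts them. *)
have S3 s y : \sum_k b k s (bar y) (bar w) u * (b (k - q) s (bar y) (bar v) x)^*
    = K3 * \sum_k (pair k g)^* * ((b (- k) (bar y) v (bar s) x)^*
                                  * b (- k) (bar y) w (bar s) u).
  transitivity (\sum_k pair 0 k * b k s (bar y) (bar w) u
                  * (b (k - q) s (bar y) (bar v) x)^*).
    by apply: eq_bigr => k _; rewrite pair0l mul1r.
  rewrite (parseval (fun h => b h s (bar y) (bar w) u)
                    (fun h => b h s (bar y) (bar v) x)).
  rewrite mulr_sumr; apply: eq_bigr => k _ /=.
  rewrite addr0 !rot !barK !conjE.
  have -> : chi u k = pair p k * chi x k by rewrite -Hp divfK // chi_neq0.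
  have -> : pair p k = pair k q * pair k g by rewrite -pairDr subrK pairC.
  rewrite /K3.
  field: eps_sq (epsL_sq s).
  by rewrite ?a_neq0 ?pair_neq0 ?chi_neq0 ?c_neq0.
have S4 : \sum_s \sum_y \sum_k (pair k g)^* * ((b (- k) (bar y) v (bar s) x)^*
                                  * b (- k) (bar y) w (bar s) u)
    = (g == 0)%:R * (w == v)%:R * (u == x)%:R - (w == u)%:R * (v == x)%:R / d.
  (* The 1/n term of p4 is summed over all [k] and yields the delta at [g = 0]; the 1/d term lives
     at [k = 0] and survives for every [g]. *)
  transitivity (\sum_k ((pair k g)^* * ((w == v)%:R * (u == x)%:R / n)
      - (k == 0)%:R * ((pair k g)^* * ((w == u)%:R * (v == x)%:R / d)))).
    transitivity (\sum_k \sum_y \sum_s (pair k g)^*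
        * ((b (- k) (bar y) v (bar s) x)^* * b (- k) (bar y) w (bar s) u)).
      rewrite exchange_big [RHS]exchange_big; apply: eq_bigr => y _.
      by rewrite exchange_big.
    apply: eq_bigr => k _.
    have := P4 (- k) w v u x; rewrite oppr_eq0 => P.
    transitivity ((pair k g)^* * \sum_r \sum_t
        (b (- k) r v t x)^* * b (- k) r w t u).
      rewrite mulr_sumr -[RHS]sum_bar; apply: eq_bigr => y _.
      by rewrite mulr_sumr -[RHS]sum_bar.
    by rewrite P mulrBr !mulrA; congr (_ - _); rewrite -!mulrA mulrCA.
  rewrite sumrB -mulr_suml pair_sum_conj.
  rewrite (sum_deltal (fun k => (pair k g)^*
    * ((w == u)%:R * (v == x)%:R / d)) 0) pair0l conjC1 mul1r.
  by congr (_ - _); field; rewrite n_neq0.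
rewrite S1; have -> : \sum_s \sum_y \sum_h
        pair q h * b h w s y u * (b (h - g) v s y x)^*
    = K2 * (K3 * ((g == 0)%:R * (w == v)%:R * (u == x)%:R
                  - (w == u)%:R * (v == x)%:R / d)).
  rewrite -S4 !mulr_sumr; apply: eq_bigr => s _; rewrite !mulr_sumr.
  by apply: eq_bigr => y _; rewrite S2 S3.
rewrite !mulrBr [v == w]eq_sym [x == u]eq_sym [u == w]eq_sym [x == v]eq_sym.
congr (_ - _).
  case: (g =P 0) => [g0|_]; last by rewrite !(mul0r, mulr0).
  case: (w =P v) => [wv|_]; last by rewrite !(mul0r, mulr0).
  case: (u =P x) => [ux|_]; last by rewrite !(mul0r, mulr0).
  have p0 : p = 0.
    by apply: pair_nondeg => h; rewrite -Hp ux divff // chi_neq0.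
  rewrite /K1 /K2 /K3 /q p0 g0 wv ux subrr a0 chi0 chi0 pair0l !epsL_barE.
  field: eps_sq (epsL_sq v).
  by rewrite ?a_neq0 ?chi_neq0 ?c_neq0.
case: (w =P u) => [wu|_]; last by rewrite !(mul0r, mulr0).
case: (v =P x) => [vx|_]; last by rewrite !(mul0r, mulr0).
(* On the support of the 1/d term, [w = u] and [v = x], the product of [K1], [K2], [K3] reduces to
   the expression that [gauss_shift] shows to be 1. *)
have shift := gauss_shift Hp.
transitivity (d^-1 * (c u ^+ 3 * (c x ^+ 3)^-1 * chi x p * (a p)^-1)).
  by rewrite shift !mulr1.
rewrite /K1 /K2 /K3 /q wu vx !epsL_barE aD a_even chiD chiN pairDl pairNl.
rewrite pairNr pair_diag (_ : true%:R = 1) //.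
move: (d) d_neq0 => d' d'0.
field: eps_sq (epsL_sq u) (epsL_sq x).
by rewrite ?d'0 ?a_neq0 ?pair_neq0 ?chi_neq0 ?c_neq0.
Qed.

End Scalars.

Theorem theorem8p7 (R : realType) (G : finZmodType) (m : nat) (eps : R[i])
    (pair : G -> G -> R[i])
    (K0 : vectType R[i]) (ip : {dot K0 for (@conjC R[i])})
    (A : G -> 'End(K0)) (C : 'End(K0)) (J : K0 -> K0)
    (L : finType) (e : L -> K0) (bar : L -> L)
    (a : G -> R[i]) (chi : L -> G -> R[i]) (c epsL : L -> R[i])
    (D : algType R[i]) (star : D -> D) (nrm : D -> R) (T0 : {linear K0 -> D})
    (B : G -> {linear K0 -> D})
    (Gnontriv : (1 < #|G|)%N) (m_gt0 : (0 < m)%N) (n_dvd_m : (#|G| %| m)%N)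
    (eps_sign : eps = 1 \/ eps = -1)
    (pair_bichar : symmetric_bicharacter pair)
    (pair_nondeg : nondegenerate_pairing pair)
    (dimK0 : \dim {:K0} = (m %/ #|G|)%N)
    (A_unitary : forall g, unitary ip (A g)) (C_unitary : unitary ip C)
    (AA_comm : forall g h, (A g \o A h = A h \o A g)%VF)
    (AC_comm : forall g, (A g \o C = C \o A g)%VF)
    (J_antiunitary : antiunitary ip J)
    (JJ : forall x, J (J x) = eps *: x)
    (JC : forall x, J (C x) = adjoint ip C (J x))
    (JA : forall g x, J (A g x) = adjoint ip (A (- g)) (J x))
    (AA : forall g h, (A g \o A h)%VF = pair g h *: A (g + h))
    (sumA : (sqrtn R G)^-1 *: \sum_g A g = (C^-1 \o C^-1 \o C^-1)%VF)
    (e_basis : orthonormal_basis ip e) (barK : involutive bar)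
    (A_diag : forall g t, A g (e t) = (a g * chi t g) *: e t)
    (C_diag : forall t, C (e t) = c t *: e t)
    (J_diag : forall t, J (e t) = epsL t *: e (bar t))
    (a_circle : forall g, `|a g| = 1)
    (a_even : forall g, a (- g) = a g)
    (a_mul : forall g h, a g * a h = pair g h * a (g + h))
    (chi_char : forall t, character (chi t))
    (chi_bar : forall t g, chi (bar t) g = (chi t g)^-1)
    (c_circle : forall t, `|c t| = 1)
    (c_bar : forall t, c (bar t) = c t)
    (a_chi_sum : forall t, \sum_g a g * chi t g = sqrtn R G * c t ^- 3)
    (epsL_sign : forall t, epsL t = 1 \/ epsL t = -1)
    (epsL_bar : forall t, epsL t * epsL (bar t) = eps)
    (D_cstar : cstar_algebra star nrm)
    (T0_isometry : forall xi eta, star (T0 eta) * T0 xi = ip xi eta *: 1)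
    (B_range : forall g xi, KKKstar star T0 (B g xi)) :
  operator_system m eps pair ip A C J e star T0 B
  <-> polynomial_system m eps pair bar a chi c epsL (bcoef star T0 e B).
Proof.
have J_semilin : semilin true J.
  by case: J_antiunitary => J_lin _ _ z x y; rewrite J_lin.
have n0 : (#|G|%:R : R[i]) != 0 by rewrite pnatr_eq0 -lt0n ltnW.
have card_L : (#|L|%:R : R[i]) = m%:R / #|G|%:R.
  apply: (mulIf n0); rewrite divfK // -natrM -(card_basis e_basis) dimK0.
  by rewrite divnK.
have epsL_real t : (epsL t)^* = epsL t.
  by case: (epsL_sign t) => ->; rewrite ?rmorphN rmorph1.
pose b := bcoef star T0 e B.
have rot1 := p1_rotation eps bar c epsL b pair_bichar a_even chi_char.
have rot5 := rotation_dual pair c b eps_sign a_even chi_char epsL_sign epsL_bar.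
(* The premises of the conditional equivalences are met in both directions: [rotation] follows from
   (E5) as well as from p1, and p4, p7, p8 are either given or already derived. *)
have e1 : rotation eps pair bar a chi c epsL b ->
    E1 m pair ip C J e star T0 B <-> p2 m b.
  move=> rot; rewrite (E1_coef m pair e_basis J_semilin C_diag J_diag c_bar
    epsL_real D_cstar T0_isometry B_range).
  exact: (p2_dual m eps_sign pair_bichar barK a_circle a_mul chi_char c_circle
    epsL_sign epsL_bar rot).
have e2 : rotation eps pair bar a chi c epsL b ->
    E2 m pair ip C J e star T0 B <-> p4 m b.
  move=> rot; rewrite (E2_coef m pair e_basis J_semilin C_diag J_diag c_bar
    epsL_real D_cstar T0_isometry B_range).
  exact: (p4_dual m_gt0 eps_sign barK a_circle chi_char c_circle
    epsL_sign epsL_bar rot).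
have e3 : E3 ip A e star T0 B <-> p6 chi b.
  rewrite (E3_coef e_basis A_diag D_cstar T0_isometry B_range).
  exact: (p6_dual b a_circle chi_char).
have e4 : E4 eps A J e star T0 B <-> p7 bar a chi epsL b.
  rewrite (E4_coef eps e_basis J_semilin barK A_diag J_diag epsL_real D_cstar
    T0_isometry B_range).
  exact: (p7_dual b eps_sign a_even chi_char chi_bar epsL_sign epsL_bar).
have e5 : E5 eps pair A C J e star T0 B
    <-> rotation eps pair bar a chi c epsL b.
  rewrite (E5_coef eps pair e_basis barK A_diag C_diag J_diag epsL_real D_cstar
    T0_isometry B_range).
  exact: rot5.
have e6 : rotation eps pair bar a chi c epsL b ->
    E6 m pair J e star T0 B <-> p5 m b.
  move=> rot; rewrite (E6_coef m pair e_basis J_diag epsL_real D_cstar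
    T0_isometry B_range).
  exact: (p5_dual m eps_sign barK a_circle chi_char c_circle epsL_sign
    epsL_bar rot).
have e7 : p4 m b -> E7 m ip A C J e star T0 B <-> p8 bar a chi c epsL b.
  move=> P4; rewrite (E7_coef m e_basis A_diag C_diag J_diag c_bar epsL_real
    D_cstar T0_isometry B_range).
  exact: (p8_dual m_gt0 card_L barK a_circle a_even chi_char chi_bar c_circle
    epsL_sign P4).
have e10 : p7 bar a chi epsL b -> p8 bar a chi c epsL b ->
    E10 m eps pair ip A C J e star T0 B <-> p10 m pair bar chi c epsL b.
  move=> P7 P8; rewrite (E10_coef m eps pair e_basis J_semilin A_diag C_diag
    J_diag epsL_real D_cstar T0_isometry B_range).
  exact: (p10_dual m eps_sign pair_bichar a_circle a_even chi_char c_circle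
    epsL_sign epsL_bar P7 P8).
split.
  move=> [[H1 [H2 [/e3 P6 [/e4 P7 /e5 rot]]]] [H6 [H7 [_ [_ H10]]]]].
  have P2 := (e1 rot).1 H1; have P4 := (e2 rot).1 H2; have P5 := (e6 rot).1 H6.
  have P8 := (e7 P4).1 H7.
  have P9 := p9_of_p6_p7_p8 a_circle a_even chi_char chi_bar c_circle epsL_sign
    P6 P7 P8.
  have P3 := p3_of_p2_p5 m_gt0 card_L P2 P5.
  have P10 := (e10 P7 P8).1 H10.
  by split; [split; [exact/rot1|do !split]|do !split].
move=> [[P1 [P2 [_ [P4 P5]]]] [P6 [P7 [P8 [_ P10]]]]].
have rot := rot1.1 P1.
have H8 : E8 m ip A C J e star T0 B.
  apply: (E8_of_coef e_basis J_semilin A_diag C_diag J_diag c_bar epsL_real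
    D_cstar T0_isometry B_range).
  exact: (E8_coef_of_p m_gt0 eps_sign pair_bichar pair_nondeg barK a_circle
    a_even a_mul chi_char chi_bar c_circle a_chi_sum epsL_sign epsL_bar
    rot P4 P6 P8).
have H9 : E9 eps pair ip A C star T0 B.
  apply: (E9_of_coef e_basis A_diag C_diag D_cstar T0_isometry B_range).
  exact: (E9_coef_of_p eps_sign pair_bichar barK a_circle a_even a_mul chi_char
    c_circle epsL_sign epsL_bar rot P1 P6 P8).
have H1 := (e1 rot).2 P2.
have H2 := (e2 rot).2 P4; have H6 := (e6 rot).2 P5.
have H7 := (e7 P4).2 P8; have H10 := (e10 P7 P8).2 P10.
by split; [split=> //; split=> //; split; [exact/e3|split; [exact/e4|exact/e5]]
          |do !split].
Qed.
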